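(* Let $m_i,n_i,k_i,l_i$ ($i=1,2$) be integers with $(m_i,n_i)\neq(0,0)$ and $(k_i,l_i)\neq(0,0)$ for $i=1,2$, and let $$G=\langle a,b,x,y \mid [a,b]=1,\ x^{-1}a^{m_1}b^{n_1}x=a^{m_2}b^{n_2},\ y^{-1}a^{k_1}b^{l_1}y=a^{k_2}b^{l_2}\rangle.$$ If $(|m_1|,|n_1|)\neq(|m_2|,|n_2|)$ or $(|k_1|,|l_1|)\neq(|k_2|,|l_2|)$, then $G$ is $C^*$-simple. In particular, the following groups are $C^*$-simple: (1) Wise's non-Hopfian $\mathrm{CAT}(0)$ group $W$, i.e. the group $G$ with $(m_1,n_1)=(1,0)$, $(m_2,n_2)=(2,2)$, $(k_1,l_1)=(0,1)$, $(k_2,l_2)=(2,2)$; (2) the Brady–Bridson group $\mathrm{BB}(p,r)$ for integers $0<p<r$, i.e. the group $G$ with $(m_1,n_1)=(1,0)$, $(m_2,n_2)=(r,1)$, $(k_1,l_1)=(p,0)$, $(k_2,l_2)=(r,-1)$; (3) Wise's simple curve examples $G_d$ for integers $d\geq2$, i.e. the group $G$ with $(m_1,n_1)=(d,1)$, $(m_2,n_2)=(1,1)$, $(k_1,l_1)=(1,d)$, $(k_2,l_2)=(1,1)$.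
   Context: A countable discrete group is $C^*$-simple if its reduced group $C^*$-algebra $C^*_r(G)$ is simple, i.e. has no proper nonzero closed two-sided ideal. *)

(* Defs.v *)
From HB Require Import structures.
From mathcomp Require Import all_boot all_order all_algebra.
From mathcomp Require Import generic_quotient.
From mathcomp Require Import complex.
From mathcomp Require Import all_classical all_reals.
From mathcomp Require Import ereal esum ring.

Set Implicit Arguments.
Unset Strict Implicit.
Unset Printing Implicit Defensive.

Import Order.TTheory GRing.Theory Num.Theory Normc.

Local Open Scope classical_set_scope.
Local Open Scope ring_scope.

(* A letter (s, false) stands for the generator s and (s, true) for s^-1;
   concatenation of words is the product. *)
Definition word (S : choiceType) := seq (S * bool).

Section Presentation.
Context {S : choiceType}.

Definition winv (w : word S) : word S := rev [seq (l.1, ~~ l.2) | l <- w].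

Definition wexp (s : S) (n : int) : word S :=
  match n with
  | Posz k => nseq k (s, false)
  | Negz k => nseq k.+1 (s, true)
  end.

(* The smallest congruence on words that contains the relations in rels and
   makes (s, b) and (s, ~~ b) mutually inverse. *)
Inductive pres_eq (rels : seq (word S * word S)) : word S -> word S -> Prop :=
| pres_rel u v : (u, v) \in rels -> pres_eq rels u v
| pres_cancel s b : pres_eq rels [:: (s, b); (s, ~~ b)] [::]
| pres_cat u u' v v' :
    pres_eq rels u u' -> pres_eq rels v v' -> pres_eq rels (u ++ v) (u' ++ v')
| pres_refl u : pres_eq rels u u
| pres_sym u v : pres_eq rels u v -> pres_eq rels v u
| pres_trans u v w : pres_eq rels u v -> pres_eq rels v w -> pres_eq rels u w.

Variable rels : seq (word S * word S).

Definition pres_eqb (u v : word S) : bool := `[< pres_eq rels u v >].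

Lemma pres_eqb_refl : reflexive pres_eqb.
Proof. by move=> u; apply/asboolP; exact: pres_refl. Qed.

Lemma pres_eqb_sym : symmetric pres_eqb.
Proof. by move=> u v; apply/asboolP/asboolP; exact: pres_sym. Qed.

Lemma pres_eqb_trans : transitive pres_eqb.
Proof.
move=> v u w /asboolP uv /asboolP vw; apply/asboolP; exact: pres_trans uv vw.
Qed.

Canonical pres_equiv :=
  EquivRel pres_eqb pres_eqb_refl pres_eqb_sym pres_eqb_trans.

Local Open Scope quotient_scope.

Definition presented := {eq_quot pres_equiv}.
HB.instance Definition _ := Choice.on presented.

Definition pres_class (w : word S) : presented := \pi_({eq_quot pres_equiv}) w.
Definition pres_repr (g : presented) : word S :=
  repr (g : {eq_quot pres_equiv}).

Definition pres_one := pres_class [::].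
Definition pres_mul (g h : presented) :=
  pres_class (pres_repr g ++ pres_repr h).
Definition pres_inv (g : presented) := pres_class (winv (pres_repr g)).

Lemma pres_reprK : cancel pres_repr pres_class.
Proof. exact: (@reprK _ {eq_quot pres_equiv}). Qed.

Lemma pres_classP (u v : word S) :
  pres_class u = pres_class v <-> pres_eq rels u v.
Proof.
split=> [uv|h]; first by apply/asboolP; exact/(eqquotP {eq_quot pres_equiv}).
by apply/(eqquotP {eq_quot pres_equiv}); exact/asboolP.
Qed.

Lemma pres_reprP (u : word S) : pres_eq rels (pres_repr (pres_class u)) u.
Proof. by apply/pres_classP; rewrite pres_reprK. Qed.

Lemma pres_mulE u v : pres_mul (pres_class u) (pres_class v) = pres_class (u ++ v).
Proof. by apply/pres_classP; apply: pres_cat; exact: pres_reprP. Qed.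

Lemma winv_cat u v : winv (u ++ v) = winv v ++ winv u.
Proof. by rewrite /winv map_cat rev_cat. Qed.

Lemma winvK : involutive winv.
Proof.
move=> u; rewrite /winv map_rev revK -map_comp -[RHS]map_id.
by apply: eq_map => -[s b] /=; rewrite negbK.
Qed.

Lemma pres_eq_winvr u : pres_eq rels (u ++ winv u) [::].
Proof.
elim: u => [|[s b] u IHu]; first exact: pres_refl.
rewrite -cat1s winv_cat -catA (catA u).
apply: pres_trans (pres_cancel _ s b).
exact: (pres_cat (pres_refl _ [:: (s, b)])
                 (pres_cat IHu (pres_refl _ [:: (s, ~~ b)]))).
Qed.

Lemma pres_eq_winvl u : pres_eq rels (winv u ++ u) [::].
Proof. by rewrite -[X in _ ++ X]winvK; exact: pres_eq_winvr. Qed.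

Lemma pres_eq_winv u v : pres_eq rels u v -> pres_eq rels (winv u) (winv v).
Proof.
move=> uv; apply: (@pres_trans _ _ (winv u ++ (v ++ winv v))).
  rewrite -[X in pres_eq _ X _]cats0.
  by apply: pres_cat (pres_refl _ _) (pres_sym (pres_eq_winvr v)).
rewrite catA -[X in pres_eq _ _ X]cat0s.
apply: pres_cat (pres_refl _ _).
apply: pres_trans (pres_eq_winvl u).
exact: pres_cat (pres_refl _ _) (pres_sym uv).
Qed.

Lemma pres_invE u : pres_inv (pres_class u) = pres_class (winv u).
Proof. by apply/pres_classP; apply: pres_eq_winv; exact: pres_reprP. Qed.

Lemma pres_mulA : associative pres_mul.
Proof.
move=> g h k; rewrite -[g]pres_reprK -[h]pres_reprK -[k]pres_reprK.
by rewrite !pres_mulE catA.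
Qed.

Lemma pres_mul1g : left_id pres_one pres_mul.
Proof. by move=> g; rewrite -[g]pres_reprK /pres_one pres_mulE. Qed.

Lemma pres_mulg1 : right_id pres_one pres_mul.
Proof. by move=> g; rewrite -[g]pres_reprK /pres_one pres_mulE cats0. Qed.

Lemma pres_mulVg : left_inverse pres_one pres_inv pres_mul.
Proof.
move=> g; rewrite -[g]pres_reprK pres_invE pres_mulE.
by apply/pres_classP; exact: pres_eq_winvl.
Qed.

Lemma pres_mulgV : right_inverse pres_one pres_inv pres_mul.
Proof.
move=> g; rewrite -[g]pres_reprK pres_invE pres_mulE.
by apply/pres_classP; exact: pres_eq_winvr.
Qed.

HB.instance Definition _ := isGroup.Build presented
  pres_mulA pres_mul1g pres_mulg1 pres_mulVg pres_mulgV.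

End Presentation.

Arguments presented {S} rels.

Section HilbertSpace.
Context (R : realType) (G : choiceType).

Definition sqsum (f : G -> R[i]) : \bar R :=
  (\esum_(g in [set: G]) (normc (f g) ^+ 2)%:E)%E.

Definition l2_pred : {pred G -> R[i]} := fun f => `[< (sqsum f < +oo)%E >].

Lemma esumZ_le (c : R) (u : G -> \bar R) : 0 <= c -> (forall g, 0 <= u g)%E ->
  (\esum_(g in [set: G]) (c%:E * u g) <= c%:E * \esum_(g in [set: G]) u g)%E.
Proof.
move=> c0 u0; apply: ge_ereal_sup => _ [A [finA _] <-].
rewrite -ge0_mule_fsumr //; apply: lee_wpmul2l; first by rewrite lee_fin.
by apply: ereal_sup_ubound; exists A.
Qed.

Lemma sqnormc_scaleD_le (c x y : R[i]) :
  normc (c * x + y) ^+ 2 <= 2 * normc c ^+ 2 * normc x ^+ 2 + 2 * normc y ^+ 2.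
Proof.
have n0 (z : R[i]) : 0 <= normc z by case: z => p q; exact: sqrtr_ge0.
apply: (@le_trans _ _ ((normc (c * x) + normc y) ^+ 2)).
  by rewrite lerXn2r ?nnegrE ?addr_ge0 ?n0 ?le_normcD.
rewrite normcM -mulrA -exprMn; set p := _ * _; set q := normc y.
rewrite -subr_ge0.
have -> : 2 * p ^+ 2 + 2 * q ^+ 2 - (p + q) ^+ 2 = (p - q) ^+ 2 by ring.
exact: sqr_ge0.
Qed.

Lemma l2_submod : submod_closed l2_pred.
Proof.
split.
  apply/asboolP; rewrite /sqsum esum1 ?ltry// => g _.
  by rewrite normc0 expr0n.
move=> c f h /asboolP f2 /asboolP h2; apply/asboolP.
have sq0 (k : G -> R[i]) g : (0 <= (normc (k g) ^+ 2)%:E)%E.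
  by rewrite lee_fin sqr_ge0.
apply: (@le_lt_trans _ _
    ((2 * normc c ^+ 2)%:E * sqsum f + 2%:E * sqsum h)%E); last first.
  apply: lte_add_pinfty; last exact: lte_mul_pinfty.
  by apply: lte_mul_pinfty => //; rewrite lee_fin mulr_ge0 ?sqr_ge0.
apply: (@le_trans _ _ (\esum_(g in [set: G])
    ((2 * normc c ^+ 2)%:E * (normc (f g) ^+ 2)%:E +
     2%:E * (normc (h g) ^+ 2)%:E))%E).
  by apply: le_esum => g _; rewrite -!EFinM -EFinD lee_fin sqnormc_scaleD_le.
rewrite esumD; last 2 first.
- by move=> g _; rewrite mule_ge0 // lee_fin mulr_ge0 ?sqr_ge0.
- by move=> g _; rewrite mule_ge0 // lee_fin.
by apply: leeD; apply: esumZ_le => //; rewrite mulr_ge0 ?sqr_ge0.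
Qed.

HB.instance Definition _ := GRing.isSubmodClosed.Build R[i] (G -> R[i]) l2_pred
  l2_submod.

Record l2 := L2 { l2_fun :> G -> R[i]; _ : l2_fun \in l2_pred }.

HB.instance Definition _ := [isSub for l2_fun].
HB.instance Definition _ := [Choice of l2 by <:].
HB.instance Definition _ := [SubChoice_isSubLmodule of l2 by <:].

Definition l2norm (f : l2) : R := Num.sqrt (fine (sqsum f)).

(* Equal to +oo exactly when the linear operator T is unbounded. *)
Definition opnorm (T : l2 -> l2) : \bar R :=
  ereal_sup [set (l2norm (T f))%:E | f in [set f | l2norm f <= 1]].

Definition bounded_op : set (l2 -> l2) :=
  [set T | linear T /\ (opnorm T < +oo)%E].

Definition norm_closure (A : set (l2 -> l2)) : set (l2 -> l2) :=
  [set T | bounded_op T /\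
    forall eps : R, 0 < eps -> exists2 U, A U & (opnorm (T - U)%R < eps%:E)%E].

(* A is meant to be a subalgebra of bounded_op. *)
Definition closed_ideal (A I : set (l2 -> l2)) : Prop :=
  [/\ I `<=` A,
      I 0,
      (forall (c : R[i]) T U, I T -> I U -> I (c *: T + U)),
      (forall T U, A T -> I U -> I (T \o U) /\ I (U \o T)) &
      norm_closure I `<=` I].

End HilbertSpace.

Section CstarSimple.
Context (R : realType) (G : groupType).

Lemma lreg_subproof (g : G) (f : l2 R G) :
  (fun h => f (g^-1 * h)%g) \in @l2_pred R G.
Proof.
case: f => f /= /asboolP f2; apply/asboolP; apply: le_lt_trans f2.
rewrite /sqsum [leRHS](reindex_esum [set: G] _ (fun h => (g^-1 * h)%g)) //.
split => //=; first by move=> x y _ _; exact: mulgI.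
by move=> h _; exists (g * h)%g => //=; rewrite mulgA mulVg mul1g.
Qed.

Definition lreg (g : G) (f : l2 R G) : l2 R G := L2 (lreg_subproof g f).

Definition group_ops : set (l2 R G -> l2 R G) :=
  [set T | exists (s : seq G) (c : G -> R[i]), T = \sum_(g <- s) c g *: lreg g].

(* group_ops, the image of the group algebra under the left regular
   representation, is already stable under adjoints. *)
Definition Cstar_red : set (l2 R G -> l2 R G) := norm_closure group_ops.

Definition Cstar_simple : Prop :=
  forall I, closed_ideal Cstar_red I -> I = [set 0] \/ I = Cstar_red.

End CstarSimple.

Local Notation wgen i := (@Ordinal 4 i isT).
Definition ga : 'I_4 := wgen 0.
Definition gb : 'I_4 := wgen 1.
Definition gx : 'I_4 := wgen 2.
Definition gy : 'I_4 := wgen 3.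

Definition ab_word (v : int * int) : word 'I_4 := wexp ga v.1 ++ wexp gb v.2.

Definition conj_word (t : 'I_4) (u : word 'I_4) : word 'I_4 :=
  wexp t (-1) ++ u ++ wexp t 1.

(* <a, b, x, y | [a, b] = 1, x^-1 a^m1 b^n1 x = a^m2 b^n2,
                y^-1 a^k1 b^l1 y = a^k2 b^l2> for mni = (mi, ni), kli = (ki, li). *)
Definition two_stable_rels (mn1 mn2 kl1 kl2 : int * int) :
    seq (word 'I_4 * word 'I_4) :=
  [:: (wexp ga (-1) ++ wexp gb (-1) ++ wexp ga 1 ++ wexp gb 1, [::]);
      (conj_word gx (ab_word mn1), ab_word mn2);
      (conj_word gy (ab_word kl1), ab_word kl2)].

Definition two_stable_group (mn1 mn2 kl1 kl2 : int * int) : groupType :=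
  presented (two_stable_rels mn1 mn2 kl1 kl2).

Definition Wise_W : groupType :=
  two_stable_group (1, 0) (2, 2) (0, 1) (2, 2).

Definition Brady_Bridson (p r : int) : groupType :=
  two_stable_group (1, 0) (r, 1) (p, 0) (r, -1).

Definition Wise_simple_curve (d : int) : groupType :=
  two_stable_group (d, 1) (1, 1) (1, d) (1, 1).

(* Main.v *)
Require Import Defs.
From mathcomp Require Import all_boot all_order all_algebra.
From mathcomp Require Import all_classical all_reals.
From mathcomp Require Import complex ereal esum ring lra zify.

Import Order.TTheory GRing.Theory Num.Theory Normc.
Local Open Scope ring_scope.

(** Simplicity comes from Powers' averaging method.  A finite set [F] of
    nontrivial elements of a group is treated with a subset [C] that every
    element of [F] moves off itself, and infinitely many elements [g i] such that
    the translates by [g i] of the complement of [C] are pairwise disjoint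
    ([powers_property]).  For [f] in [F], the operator
    [lreg (g i * f * (g i)^-1)] then maps everything outside the [i]-th translate
    into it, so that the sum of [n] such operators has squared norm at most
    [4 * n] ([gain_powers]) and their mean has norm at most [2 / sqrt n].  Let
    [T] be a nonzero element of a closed ideal.  After a translation its
    coefficient [c] at 1 is nonzero; approximate it by a finite combination of
    translations, and average its conjugates by the [g i].  All terms of that
    combination except the one at 1 become small together, so the averages, which
    stay in the ideal, approach [c] times the identity.  The ideal therefore
    contains the identity ([powers_Cstar_simple]).

    All norm estimates are made on squares: convexity of the square,
    [sqnormc_sum], replaces the triangle inequality in l2.

    The group is an HNN extension of the lattice Z^2 with two stable letters, and
    the sets [C] come from its Bass-Serre tree.  Vertices are normal forms:
    lists of pairs (coset representative, stable letter) without backtracking.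
    The generators act on normal forms and respect the relations ([wact_rel]).
    The cylinder of a list [w] is the set of vertices that extend [w], and the
    complement of a cylinder always has infinitely many disjoint translates,
    because an edge group is a line in Z^2 and has infinite index.

    It remains to find, inside any cylinder, a smaller one that a given [f]
    different from 1 moves off itself ([branching]); doing this for the elements
    of [F] one after the other gives [C].  Deep enough in the tree, [f] maps the
    cylinder of [w] to the cylinder of some [w'], up to the action of a lattice
    element [a] ([carries_exists]).  If [w'] and [w] have different lengths, one
    well-chosen further letter separates the two cylinders.  If [w' = w], then
    [a] is not 0, and one follows the path labelled by a single stable letter
    [s0].  As long as this path is fixed, [a] equals a multiple [c] of the edge
    vector, and every step replaces [c] by some [c'] with [|c'| < |c|], provided
    that one coordinate of the edge vector of [s0] shrinks in absolute value when
    the edge is crossed.  The hypothesis on absolute values says that some stable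
    letter or its inverse has this property ([contracting]).  Hence the path is
    eventually moved ([nseq_moved]). *)

Set Implicit Arguments.
Unset Strict Implicit.
Unset Printing Implicit Defensive.

(** * Square-summable functions *)

Section SquareSums.
Context {R : realType}.
Local Open Scope classical_set_scope.

Lemma normc_ge0 (z : R[i]) : 0 <= normc z.
Proof. by case: z => p q; exact: sqrtr_ge0. Qed.

Lemma normc_sum (I : Type) (s : seq I) (z : I -> R[i]) :
  normc (\sum_(i <- s) z i) <= \sum_(i <- s) normc (z i).
Proof.
elim: s => [|i s IHs]; first by rewrite !big_nil normc0.
by rewrite !big_cons (le_trans (le_normcD _ _)) // lerD2l.
Qed.

Lemma sqnormc_sum (I : Type) (s : seq I) (z : I -> R[i]) :
  normc (\sum_(i <- s) z i) ^+ 2 <=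
  (size s)%:R * \sum_(i <- s) normc (z i) ^+ 2.
Proof.
pose S := \sum_(i <- s) normc (z i).
have : S ^+ 2 <= (size s)%:R * \sum_(i <- s) normc (z i) ^+ 2.
  rewrite /S; elim: s {S} => [|i s IHs].
    by rewrite !big_nil expr0n mul0r.
  rewrite !big_cons /=; set S := \sum_(j <- s) normc (z j) in IHs *.
  set Q := \sum_(j <- s) _ in IHs *; set x := normc (z i).
  have Q0 : 0 <= Q by apply: sumr_ge0 => j _; exact: sqr_ge0.
  have [n0|n0] := eqVneq (size s) 0%N.
    rewrite n0 mul0r in IHs *.
    have -> : S = 0 by apply/eqP; rewrite -sqrf_eq0 eq_le IHs sqr_ge0.
    by rewrite addr0 mul1r lerDl.
  have n1 : 1 <= (size s)%:R :> R by rewrite ler1n lt0n.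
  rewrite -natr1; set n := (size s)%:R in IHs n1 *.
  have n0' : 0 < n by lra.
  rewrite -(ler_pM2l n0') -subr_ge0.
  have -> : n * ((n + 1) * (x ^+ 2 + Q)) - n * (x + S) ^+ 2 =
     (n * x - S) ^+ 2 + (n + 1) * (n * Q - S ^+ 2) by ring.
  by rewrite addr_ge0 ?sqr_ge0 ?mulr_ge0 ?subr_ge0//; lra.
apply: le_trans; rewrite lerXn2r ?nnegrE ?normc_ge0 //.
  by apply: sumr_ge0 => i _; exact: normc_ge0.
exact: normc_sum.
Qed.

Context {G : choiceType}.
Implicit Types f : G -> R[i].

Local Open Scope ereal_scope.

Lemma sqsum_term_ge0 f g : 0 <= (normc (f g) ^+ 2)%:E.
Proof. by rewrite lee_fin sqr_ge0. Qed.

Lemma sqsum_ge0 f : 0 <= sqsum f.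
Proof. by apply: esum_ge0 => g _; exact: sqsum_term_ge0. Qed.

Lemma sqsum0 : sqsum (fun _ : G => 0%R : R[i]) = 0.
Proof. by apply: esum1 => g _; rewrite normc0 expr0n. Qed.

Lemma sqsumZ_le (c : R[i]) f :
  sqsum (fun g => c * f g)%R <= (normc c ^+ 2)%:E * sqsum f.
Proof.
apply: le_trans (esumZ_le _ _); [|exact: sqr_ge0|exact: sqsum_term_ge0].
by apply: le_esum => g _; rewrite normcM exprMn EFinM.
Qed.

(** The factor [size s] is sharp for equal terms, so that averaging does not increase
    squared norms. *)
Lemma sqsum_sum_le (I : choiceType) (s : seq I) (F : I -> G -> R[i]) :
  sqsum (fun g => \sum_(i <- s) F i g)%R <=
  (size s)%:R%:E * \sum_(i <- s) sqsum (F i).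
Proof.
apply: (@le_trans _ _ (\esum_(g in [set: G])
   ((size s)%:R%:E * \sum_(i <- s) (normc (F i g) ^+ 2)%:E))).
  by apply: le_esum => g _; rewrite sumEFin -EFinM lee_fin sqnormc_sum.
apply: le_trans.
  apply: esumZ_le => // g; apply: sume_ge0 => i _; exact: sqsum_term_ge0.
apply: lee_wpmul2l; first by rewrite lee_fin.
by rewrite esum_sum // => g i _ _; exact: sqsum_term_ge0.
Qed.

Lemma sum_le_sqsum f (s : seq G) : uniq s ->
  (\sum_(g <- s) normc (f g) ^+ 2)%R%:E <= sqsum f.
Proof.
move=> us; rewrite -sumEFin; apply: esum_ge.
exists [set` s]; first by split; [exact: finite_seq|].
by rewrite fsbig_seq.
Qed.

End SquareSums.

(** * Squared operator bounds *)

Section Powers1.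
Context {R : realType} {G : groupType}.
Local Open Scope classical_set_scope.
Implicit Types (T U : l2 R G -> l2 R G) (f : l2 R G) (K e : R).

(** [K] bounds the square of the operator norm: bounds for sums then follow from
    [sqsum_sum_le], and no square root is taken before the end. *)
Definition gain K T := forall f, (sqsum (T f) <= K%:E * sqsum f)%E.

Lemma l2_fin f : sqsum f = (fine (sqsum f))%:E.
Proof.
rewrite fineK // ge0_fin_numE; last exact: sqsum_ge0.
by case: f => f /= /asboolP.
Qed.

Lemma fine_sqsum_ge0 f : 0 <= fine (sqsum f).
Proof. by apply: fine_ge0; exact: sqsum_ge0. Qed.

Lemma linear_op0 T : linear T -> T 0 = 0.
Proof.
move=> linT; have := linT 1 0 0; rewrite !scale1r addr0 => /eqP.
by rewrite -subr_eq0 opprD addNKr oppr_eq0 => /eqP.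
Qed.

Lemma linear_opZ T c f : linear T -> T (c *: f) = c *: T f.
Proof.
by move=> linT; rewrite -[c *: f]addr0 linT linear_op0 // addr0.
Qed.

Lemma sqsum0_eq0 f : sqsum f = 0%E -> f = 0.
Proof.
move=> f0; apply/val_inj/funext => g /=.
have := @sum_le_sqsum R _ f [:: g] isT.
rewrite f0 big_seq1 lee_fin => fg.
by apply: eq0_normc; apply/eqP; rewrite -sqrf_eq0 eq_le fg sqr_ge0.
Qed.

Lemma opnorm_le e T : 0 <= e -> gain (e ^+ 2) T -> (opnorm T <= e%:E)%E.
Proof.
move=> e0 gT; apply: ge_ereal_sup => _ [f /= f1 <-]; rewrite lee_fin.
have f2 : fine (sqsum f) <= 1.
  by rewrite -(sqr_sqrtr (fine_sqsum_ge0 f)) expr_le1 ?sqrtr_ge0.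
rewrite /l2norm -(ger0_norm e0) -sqrtr_sqr ler_wsqrtr //.
have := gT f; rewrite l2_fin [X in (_ <= _ * X)%E]l2_fin -EFinM lee_fin.
by move=> /le_trans; apply; rewrite ler_piMr ?sqr_ge0.
Qed.

(** Rescaling to the unit ball; the case of a zero vector is separate because it
    cannot be rescaled. *)
Lemma gain_opnorm e T : linear T -> (opnorm T < e%:E)%E -> gain (e ^+ 2) T.
Proof.
move=> linT Te.
have le_e f : l2norm f <= 1 -> l2norm (T f) < e.
  move=> f1; rewrite -lte_fin; apply: le_lt_trans Te.
  by apply: ereal_sup_ubound; exists f.
have e0 : 0 < e.
  apply: (@le_lt_trans _ _ (l2norm (T 0))); first exact: sqrtr_ge0.
  by apply: le_e; rewrite /l2norm [sqsum _]sqsum0 sqrtr0.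
move=> f; set q := fine (sqsum f).
have q0 : 0 <= q by exact: fine_sqsum_ge0.
have [q00|q_neq0] := eqVneq q 0.
  have -> : f = 0 by apply: sqsum0_eq0; rewrite l2_fin -/q q00.
  by rewrite linear_op0 // [leLHS]sqsum0 [sqsum _]sqsum0 mule0.
have {}q0 : 0 < q by rewrite lt_def q_neq0.
pose c : R[i] := (Num.sqrt q)%:C%C.
have c2 : normc c ^+ 2 = q.
  by rewrite /c /= expr0n addr0 sqrtr_sqr ger0_norm ?sqrtr_ge0 // sqr_sqrtr // ltW.
have c0 : c != 0.
  by apply: contraNneq q_neq0 => c0; rewrite -c2 c0 normc0 expr0n.
have cf1 : l2norm (c^-1 *: f) <= 1.
  rewrite /l2norm -[leRHS]sqrtr1 ler_wsqrtr // -lee_fin -l2_fin.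
  apply: le_trans (sqsumZ_le c^-1 f) _.
  by rewrite l2_fin -EFinM lee_fin normcV exprVn c2 mulVf.
have := le_e _ cf1; rewrite linear_opZ // => Tce.
have -> : T f = c *: (c^-1 *: T f) by rewrite scalerA divff // scale1r.
apply: le_trans (sqsumZ_le c _) _.
rewrite c2 [X in (_ <= _ * X)%E]l2_fin -/q (muleC (e ^+ 2)%:E).
apply: lee_wpmul2l; first by rewrite lee_fin ltW.
rewrite l2_fin lee_fin -(sqr_sqrtr (fine_sqsum_ge0 _)).
by rewrite lerXn2r ?nnegrE ?sqrtr_ge0 ?ltW.
Qed.

Lemma gain_bounded K T : 0 <= K -> linear T -> gain K T -> bounded_op T.
Proof.
move=> K0 linT gT; split => //.
apply: (@le_lt_trans _ _ (Num.sqrt K)%:E); last exact: ltry.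
by apply: opnorm_le; rewrite ?sqrtr_ge0 // sqr_sqrtr.
Qed.

Lemma gain_le K K' T : K <= K' -> gain K T -> gain K' T.
Proof.
move=> KK gT f; apply: le_trans (gT f) _.
by apply: lee_wpmul2r; [exact: sqsum_ge0|rewrite lee_fin].
Qed.

Lemma gainZ c K T : gain K T -> gain (normc c ^+ 2 * K) (c *: T).
Proof.
move=> gT f; apply: le_trans (sqsumZ_le c _) _.
rewrite (EFinM _ K) -muleA; apply: lee_wpmul2l; last exact: gT.
by rewrite lee_fin sqr_ge0.
Qed.

Lemma l2_fun_sum (I : Type) (s : seq I) (F : I -> l2 R G) g :
  (\sum_(i <- s) F i) g = \sum_(i <- s) F i g.
Proof.
by elim: s => [|i s IHs]; rewrite ?big_nil // !big_cons -IHs.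
Qed.

Lemma gain_sum (I : choiceType) (s : seq I) (K : I -> R)
    (T : I -> l2 R G -> l2 R G) :
  (forall i, i \in s -> gain (K i) (T i)) ->
  gain ((size s)%:R * \sum_(i <- s) K i) (\sum_(i <- s) T i).
Proof.
move=> gT f; rewrite fct_sumE.
have -> : l2_fun (\sum_(i <- s) T i f) = fun g => \sum_(i <- s) T i f g.
  by apply/funext => g; rewrite l2_fun_sum.
apply: le_trans (sqsum_sum_le _ _) _; rewrite EFinM -muleA.
apply: lee_wpmul2l; first by rewrite lee_fin.
rewrite (l2_fin f) -EFinM mulr_suml -sumEFin big_seq [leRHS]big_seq.
by apply: lee_sum => i si; rewrite EFinM -l2_fin; exact: gT.
Qed.

Lemma sqsum_translate (g : G) (f : G -> R[i]) :
  sqsum (fun h => f (g * h)%g) = sqsum f.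
Proof.
rewrite /sqsum [RHS](reindex_esum [set: G] _ (fun h => (g * h)%g)) //.
split => //=; first by move=> x y _ _; exact: mulgI.
by move=> h _; exists (g^-1 * h)%g => //=; rewrite mulgA mulgV mul1g.
Qed.

Lemma gain_lreg g : gain 1 (@lreg R G g).
Proof. by move=> f; rewrite mul1e [leLHS](sqsum_translate g^-1 f). Qed.

Lemma gain_id : gain 1 id.
Proof. by move=> f; rewrite mul1e. Qed.

Lemma linear_lreg g : linear (@lreg R G g).
Proof. by move=> c f h; apply: val_inj. Qed.

Lemma big_at_most_one (V : nmodType) (n : nat) (P : 'I_n -> Prop) (F : 'I_n -> V) :
  (forall i j, P i -> P j -> i = j) -> (forall i, ~ P i -> F i = 0) ->
  \sum_i F i = 0 \/ exists i, \sum_i F i = F i.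
Proof.
move=> P1 F0; have [[i Pi]|nP] := pselect (exists i, P i).
  right; exists i; rewrite (bigD1 i) //= big1 ?addr0 // => j ji.
  by apply: F0 => Pj; rewrite (P1 _ _ Pi Pj) eqxx in ji.
by left; apply: big1 => i _; apply: F0 => Pi; apply: nP; exists i.
Qed.

(** Split each [lreg (k i) xi] into the part coming from [D i] and the part coming
    from its complement.  The inputs of the parts of the first kind have disjoint
    supports, and so have the outputs of the parts of the second kind, since [k i]
    maps the complement of [D i] into [D i].  Each of the two sums thus has squared
    norm at most [n] times that of [xi], and adding them costs a factor 4. *)
Lemma gain_powers n (k : 'I_n -> G) (D : 'I_n -> set G) :
  (forall i j h, D i h -> D j h -> i = j) ->
  (forall i h, ~ D i h -> D i (k i * h)%g) ->
  gain (4 * n%:R) (\sum_i lreg (k i)).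
Proof.
move=> Ddisj Dk xi.
pose A i h : R[i] := if `[< D i ((k i)^-1 * h)%g >] then xi ((k i)^-1 * h)%g else 0.
pose B i h : R[i] := if `[< D i ((k i)^-1 * h)%g >] then 0 else xi ((k i)^-1 * h)%g.
pose E i h : R[i] := if `[< D i h >] then xi h else 0.
have -> : l2_fun ((\sum_i lreg (k i)) xi) =
    fun h => \sum_(b <- [:: true; false]) \sum_i (if b then A i h else B i h).
  apply/funext => h; rewrite fct_sumE l2_fun_sum !big_cons big_nil addr0.
  rewrite -big_split /=; apply: eq_bigr => i _.
  by rewrite /A /B; case: ifP; rewrite ?addr0 ?add0r.
apply: le_trans (sqsum_sum_le _ _) _; rewrite !big_cons big_nil adde0 /=.
have sq0 (f : G -> R[i]) g := sqsum_term_ge0 f g.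
have Ale : (sqsum (fun h => (\sum_i A i h)%R) <= n%:R%:E * sqsum xi)%E.
  apply: le_trans (sqsum_sum_le _ _) _.
  rewrite /index_enum -enumT size_enum_ord enumT.
  apply: lee_wpmul2l; first by rewrite lee_fin.
  rewrite (eq_bigr (fun i => sqsum (E i))); last first.
    by move=> i _; exact: (sqsum_translate (k i)^-1%g (E i)).
  rewrite /sqsum -(esum_sum (I := setT)) //; apply: le_esum => h _.
  rewrite sumEFin lee_fin.
  have := @big_at_most_one _ _ (fun i => D i h) (fun i => normc (E i h) ^+ 2).
  case.
  - by move=> i j; exact: Ddisj.
  - by move=> i Dih; rewrite /E; case: asboolP => //; rewrite normc0 expr0n.
  - by move=> ->; exact: sqr_ge0.
  by case=> i ->; rewrite /E; case: ifP => // _; rewrite normc0 expr0n sqr_ge0.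
have Ble : (sqsum (fun h => (\sum_i B i h)%R) <= n%:R%:E * sqsum xi)%E.
  apply: (@le_trans _ _ (\sum_(i < n) sqsum (lreg (k i) xi))%E); last first.
    rewrite (eq_bigr (fun=> sqsum xi)).
      by rewrite l2_fin sumEFin sumr_const card_ord -EFinM mulr_natl lexx.
    by move=> i _; exact: (sqsum_translate (k i)^-1%g xi).
  rewrite /sqsum -(esum_sum (I := setT)) //; apply: le_esum => h _.
  rewrite sumEFin lee_fin.
  have := @big_at_most_one _ _ (fun i => D i h) (B^~ h).
  case.
  - by move=> i j; exact: Ddisj.
  - move=> i Dih; rewrite /B; case: asboolP => // DN.
    by case: Dih; rewrite -[h](mulVKg (k i)); exact: Dk.
  - by move=> ->; rewrite normc0 expr0n; apply: sumr_ge0 => i _; exact: sqr_ge0.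
  case=> i ->; rewrite (bigD1 i) //= /B; case: ifP => _.
    rewrite normc0 expr0n addr_ge0 ?sqr_ge0 //.
    by apply: sumr_ge0 => j _; exact: sqr_ge0.
  by rewrite lerDl; apply: sumr_ge0 => j _; exact: sqr_ge0.
apply: (@le_trans _ _ (2%:R%:E * (n%:R%:E * sqsum xi + n%:R%:E * sqsum xi))%E).
  by apply: lee_wpmul2l; [rewrite lee_fin|apply: leeD].
rewrite (l2_fin xi) -!(EFinM, EFinD) lee_fin le_eqVlt; apply/orP; left; apply/eqP.
ring.
Qed.

End Powers1.

(** * Powers' averaging argument *)

(** With [D] the complement of [C], the last clause says that the translates
    [g i * D] are pairwise disjoint. *)
Definition powers_property (G : groupType) : Prop :=
  forall F : seq G, 1%g \notin F ->
  exists (C : G -> Prop) (g : nat -> G),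
    (forall f h, f \in F -> C h -> ~ C (f * h)%g) /\
    (forall i j h, i <> j -> C ((g i)^-1 * h)%g \/ C ((g j)^-1 * h)%g).

Section PowersSimple.
Context {R : realType} {G : groupType}.
Local Open Scope classical_set_scope.
Implicit Types (T U : l2 R G -> l2 R G) (f : l2 R G) (K e : R).

Lemma lregM g h f : lreg g (lreg h f) = lreg (g * h)%g f.
Proof. by apply/val_inj/funext => k /=; rewrite invgM mulgA. Qed.

Lemma lreg1 : lreg (1 : G)%g = id :> (l2 R G -> l2 R G).
Proof.
by apply/funext => f; apply/val_inj/funext => k /=; rewrite invg1 mul1g.
Qed.

Lemma gainD K K' T U : gain K T -> gain K' U -> gain (2 * (K + K')) (T + U).
Proof.
move=> gT gU.
have := @gain_sum R G bool [:: true; false] (fun b => if b then K else K')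
  (fun b => if b then T else U).
by rewrite !big_cons !big_nil !addr0; apply=> -[].
Qed.

Lemma gainN K T : gain K T -> gain K (- T).
Proof.
by move=> /(gainZ (-1)); rewrite scaleN1r normcN normc1 expr1n mul1r.
Qed.

Lemma linear_opD T U : linear T -> linear U -> linear (T + U).
Proof.
move=> lT lU c f g; change (T (c *: f + g) + U (c *: f + g) =
  c *: (T f + U f) + (T g + U g)).
by rewrite lT lU scalerDr addrACA.
Qed.

Lemma linear_op_scale c T : linear T -> linear (c *: T).
Proof.
move=> lT d f g; change (c *: T (d *: f + g) = d *: (c *: T f) + c *: T g).
by rewrite lT scalerDr !scalerA mulrC.
Qed.

Lemma linear_op_sum (I : Type) (s : seq I) (T : I -> l2 R G -> l2 R G) :
  (forall i, linear (T i)) -> linear (\sum_(i <- s) T i).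
Proof.
move=> lT; elim: s => [|i s IHs].
  by rewrite big_nil => c f g; rewrite /= scaler0 addr0.
by rewrite big_cons; exact: linear_opD.
Qed.

Lemma linear_opB T U : linear T -> linear U -> linear (T - U).
Proof. by move=> lT lU; rewrite -scaleN1r; apply/linear_opD/linear_op_scale. Qed.

(** Once repetitions are merged, the coefficients of a finite combination are its
    values on [delta]. *)
Lemma group_ops_uniq U : group_ops U ->
  exists (s : seq G) (c : G -> R[i]), uniq s /\ U = \sum_(g <- s) c g *: lreg g.
Proof.
case=> s [c ->]; exists (undup s), (fun g => c g *+ count_mem g s).
split; first exact: undup_uniq.
rewrite -big_undup_iterop_count; apply: eq_bigr => g _.
by rewrite -scalerMnl.
Qed.

Lemma group_ops_linear U : group_ops U -> linear U.
Proof.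
case=> s [c ->]; apply: linear_op_sum => g.
by apply/linear_op_scale/linear_lreg.
Qed.

Lemma Cstar_red_lreg g : Cstar_red (@lreg R G g).
Proof.
split; first by apply: gain_bounded (gain_lreg g); [exact: ler01|exact: linear_lreg].
move=> e e0; exists (lreg g).
  by exists [:: g], (fun=> 1); rewrite big_seq1 scale1r.
rewrite subrr; apply: (@le_lt_trans _ _ 0%:E); last by rewrite lte_fin.
by apply: opnorm_le => // f; rewrite expr0n mul0e [leLHS]sqsum0.
Qed.

Lemma sqsum_delta : sqsum (fun h : G => if h == 1%g then 1 else 0 : R[i]) = 1%E.
Proof.
rewrite /sqsum (eq_esum (b := fun h : G => if h \in [set 1%g] then 1%E else 0%E)).
  by rewrite -(esum_mkcond [set 1%g] (fun=> 1%E)) esum_set1.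
move=> h _; case: eqP => [->|h1]; first by rewrite mem_set // normc1 expr1n.
by rewrite memNset // normc0 expr0n.
Qed.

Lemma delta_subproof :
  (fun h : G => if h == 1%g then 1 else 0 : R[i]) \in @l2_pred R G.
Proof. by apply/asboolP; rewrite sqsum_delta ltry. Qed.

Definition delta : l2 R G := L2 delta_subproof.

Lemma group_op_delta (s : seq G) (c : G -> R[i]) h : uniq s ->
  (\sum_(g <- s) c g *: lreg g) delta h = if h \in s then c h else 0.
Proof.
move=> us; rewrite fct_sumE l2_fun_sum.
have E g : (c g *: lreg g) delta h = if g == h then c g else 0.
  transitivity (c g * (if (g^-1 * h)%g == 1%g then 1 else 0)); first by [].
  have -> : ((g^-1 * h)%g == 1%g) = (g == h).
    by apply/eqP/eqP => [gh|->]; [rewrite -[h](mulVKg g) gh mulg1|rewrite mulVg].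
  by case: ifP => _; rewrite ?mulr1 ?mulr0.
rewrite (eq_bigr _ (fun g _ => E g)) -big_mkcond /=.
case: ifPn => hs.
  rewrite -big_filter (_ : [seq g <- s | g == h] = [:: h]) ?big_seq1 //.
  exact: filter_pred1_uniq.
by rewrite big_seq_cond big1 // => g /andP[gs /eqP gh]; rewrite -gh gs in hs.
Qed.

Lemma normc_le_gain K T f h : gain K T ->
  normc (T f h) ^+ 2 <= K * fine (sqsum f).
Proof.
move=> gT; have := @sum_le_sqsum R _ (T f) [:: h] isT.
rewrite big_seq1 => /le_trans /(_ (gT f)).
by rewrite l2_fin -EFinM lee_fin.
Qed.

Lemma approx T e : Cstar_red T -> 0 < e ->
  exists2 U, group_ops U & gain (e ^+ 2) (T - U).
Proof.
move=> [[lT _] TU] e0; have [U gU TUe] := TU _ e0; exists U => //.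
by apply: gain_opnorm TUe; apply: linear_opB => //; exact: group_ops_linear.
Qed.

Lemma fine_sqsum_delta : fine (sqsum delta) = 1.
Proof. by rewrite [sqsum _]sqsum_delta. Qed.

(** An operator of the reduced algebra is determined by its value on [delta].  If
    that value vanishes, an approximation [U] of [T] within [e] has coefficients [d]
    with square sum at most [e ^+ 2], and the inequality
    [2 * |d| * |f| <= |d| ^ 2 / e + e * |f| ^ 2] bounds [U f h] by a multiple of [e]. *)
Lemma Cstar_red_eq0 T : Cstar_red T -> (forall h, T delta h = 0) -> T = 0.
Proof.
move=> AT T0; apply/funext => f; apply/val_inj/funext => h.
change (T f h = 0).
apply: eq0_normc; set x := normc _; set q := fine (sqsum f).
have q0 : 0 <= q by exact: fine_sqsum_ge0.
have x0 : 0 <= x by exact: normc_ge0.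
suff xle e : 0 < e -> x <= e * (2 * (1 + q)).
  apply/eqP; rewrite eq_le x0 andbT leNgt; apply/negP => xgt0.
  (* This choice of [e] turns the bound into [x / 2]. *)
  have q1 : 0 < 4 * (1 + q) by lra.
  have := xle (x / (4 * (1 + q))) (divr_gt0 xgt0 q1).
  have -> : x / (4 * (1 + q)) * (2 * (1 + q)) = x / 2 by field; lra.
  lra.
move=> e0; have [U gU gTU] := approx AT e0.
have [s [d [us UE]]] := group_ops_uniq gU.
have TUf := normc_le_gain f h gTU.
have dsum : \sum_(g <- s) normc (d g) ^+ 2 <= e ^+ 2.
  have := gTU delta; rewrite [sqsum delta]sqsum_delta mule1.
  rewrite -lee_fin; apply: le_trans.
  apply: le_trans (sum_le_sqsum _ us); rewrite lee_fin.
  rewrite big_seq [leRHS]big_seq; apply: ler_sum => g gs.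
  have -> : (T - U) delta g = - d g; last by rewrite normcN.
  change (T delta g - U delta g = - d g).
  by rewrite T0 UE group_op_delta // gs sub0r.
have fsum : \sum_(g <- s) normc (f (g^-1 * h)%g) ^+ 2 <= q.
  rewrite -lee_fin -l2_fin.
  have ui : uniq [seq (g^-1 * h)%g | g <- s].
    by rewrite map_inj_uniq // => g g' /mulIg /invg_inj.
  by have := sum_le_sqsum f ui; rewrite big_map.
have Uf : normc (U f h) <= e * ((1 + q) / 2).
  have -> : U f h = \sum_(g <- s) d g * f (g^-1 * h)%g.
    by rewrite UE fct_sumE l2_fun_sum.
  have : normc (\sum_(g <- s) d g * f (g^-1 * h)%g) <=
      \sum_(g <- s) (normc (d g) ^+ 2 / (2 * e) +
                     e / 2 * normc (f (g^-1 * h)%g) ^+ 2).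
    apply: le_trans (normc_sum _ _) _; apply: ler_sum => g _.
    rewrite normcM -subr_ge0.
    set a := normc _; set b := normc _.
    have -> : a ^+ 2 / (2 * e) + e / 2 * b ^+ 2 - a * b =
      (a - e * b) ^+ 2 / (2 * e) by field; lra.
    by rewrite divr_ge0 ?sqr_ge0 //; lra.
  move=> /le_trans; apply; rewrite big_split /= -mulr_suml -mulr_sumr.
  apply: (@le_trans _ _ (e ^+ 2 / (2 * e) + e / 2 * q)).
    apply: lerD; first by rewrite ler_pM2r // invr_gt0; lra.
    by rewrite ler_pM2l //; lra.
  by rewrite le_eqVlt; apply/orP; left; apply/eqP; field; lra.
have {}TUf : normc ((T - U) f h) <= e * (1 + q).
  rewrite -(@ler_pXn2r _ 2) ?nnegrE ?normc_ge0 //; last by rewrite mulr_ge0; lra.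
  apply: le_trans TUf _; rewrite exprMn -/q; apply: ler_wpM2l; first exact: sqr_ge0.
  by nra.
have : x <= normc ((T - U) f h) + normc (U f h).
  have {1}-> : x = normc ((T - U) f h + U f h).
    by rewrite /x -[T f h](subrK (U f h)).
  exact: le_normcD.
lra.
Qed.

Definition average n (g : nat -> G) T : l2 R G -> l2 R G :=
  n%:R^-1 *: \sum_(i < n) (lreg (g i) \o T \o lreg (g i)^-1%g).

Lemma averageE n g T f :
  average n g T f = n%:R^-1 *: \sum_(i < n) lreg (g i) (T (lreg (g i)^-1%g f)).
Proof.
by transitivity (n%:R^-1 *: (\sum_(i < n) (lreg (g i) \o T \o lreg (g i)^-1%g)) f);
  last rewrite fct_sumE.
Qed.

Lemma gain_conj g K T : gain K T -> gain K (lreg g \o T \o lreg g^-1%g).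
Proof.
move=> gT f; apply: le_trans (gain_lreg _ _) _; rewrite mul1e.
by apply: le_trans (gT _) _; rewrite [X in (_ * X)%E](sqsum_translate g^-1^-1%g f).
Qed.

Lemma normc_natV n : normc (n%:R^-1 : R[i]) = n%:R^-1.
Proof. by rewrite normcV normcMn normc1. Qed.

Lemma gain_average n g K T : (0 < n)%N -> gain K T -> gain K (average n g T).
Proof.
move=> n0 gT.
have nn0 : n%:R != 0 :> R by rewrite pnatr_eq0 -lt0n.
apply: gain_le (gainZ _ (gain_sum (K := fun=> K) _)) => [|i _]; last exact: gain_conj.
rewrite normc_natV sumr_const /index_enum -enumT size_enum_ord card_ord.
by rewrite -mulr_natl le_eqVlt; apply/orP; left; apply/eqP; field.
Qed.

Lemma averageD n g T U : average n g (T + U) = average n g T + average n g U.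
Proof.
apply/funext => f; transitivity (average n g T f + average n g U f); last by [].
rewrite !averageE -scalerDr -big_split /=; congr (_ *: _).
by apply: eq_bigr => i _; apply: val_inj.
Qed.

Lemma average_scalar n g c : (0 < n)%N -> average n g (c *: id) = c *: id.
Proof.
move=> n0; apply/funext => f; rewrite averageE.
rewrite (eq_bigr (fun=> c *: f)) => [|i _].
  rewrite sumr_const card_ord -[_ *: f *+ n]scaler_nat [LHS]scalerA mulVf ?scale1r //.
  by rewrite pnatr_eq0 -lt0n.
transitivity (c *: lreg (g i) (lreg (g i)^-1%g f)); first exact: val_inj.
by rewrite lregM mulgV lreg1.
Qed.

Lemma average_group_op n g (s : seq G) (d : G -> R[i]) :
  average n g (\sum_(h <- s) d h *: lreg h) =
  \sum_(h <- s) (d h / n%:R) *: \sum_(i < n) lreg (g i * h * (g i)^-1)%g.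
Proof.
apply/funext => f; rewrite averageE !fct_sumE.
transitivity (\sum_(h <- s) (d h / n%:R) *:
   (\sum_(i < n) lreg (g i * h * (g i)^-1)%g f)); last first.
  apply: eq_bigr => h _.
  transitivity ((d h / n%:R) *: (\sum_(i < n) lreg (g i * h * (g i)^-1)%g) f) => //.
  by rewrite fct_sumE.
under [RHS]eq_bigr do rewrite mulrC -scalerA.
rewrite -scaler_sumr; under [in RHS]eq_bigr do rewrite scaler_sumr.
rewrite exchange_big /=; congr (_ *: _); apply: eq_bigr => i _.
elim: s => [|h s IHs].
  by rewrite !big_nil; apply: (linear_op0 (@linear_lreg _ _ _)).
rewrite !big_cons -[d h *: _ in RHS]addr0 -IHs -!lregM.
by apply: val_inj; rewrite /= addr0.
Qed.

(** The mean of [n] conjugates of a single translation [h] has squared norm at most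
    [4 / n]; the same elements [g i] serve for all [h] in [s] at once. *)
Lemma gain_average_group_op (C : G -> Prop) (g : nat -> G) (s : seq G)
    (d : G -> R[i]) n :
  (forall x h, x \in s -> C h -> ~ C (x * h)%g) ->
  (forall i j h, i <> j -> C ((g i)^-1 * h)%g \/ C ((g j)^-1 * h)%g) ->
  (0 < n)%N ->
  gain (4 * (size s)%:R * (\sum_(h <- s) normc (d h) ^+ 2) / n%:R)
    (average n g (\sum_(h <- s) d h *: @lreg R G h)).
Proof.
move=> sC gC n0; rewrite average_group_op.
have nn0 : n%:R != 0 :> R by rewrite pnatr_eq0 -lt0n.
pose K h := normc (d h / n%:R) ^+ 2 * (4 * n%:R).
apply: gain_le (gain_sum (K := K) _) => [|h hs]; last first.
  apply: gainZ; apply: (gain_powers (D := fun i k => ~ C ((g i)^-1 * k)%g)).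
    move=> i j k nCi nCj; apply: contrapT => ij.
    have : nat_of_ord i <> j by move=> /val_inj.
    by move=> ij'; case: (gC _ _ k ij').
  move=> i k /contrapT Ck; rewrite !mulgA mulVg mul1g -mulgA.
  exact: sC.
rewrite /K -mulr_suml.
rewrite (eq_bigr (fun h => normc (d h) ^+ 2 * n%:R^-1 ^+ 2)) => [|h _]; last first.
  by rewrite normcM normc_natV exprMn.
by rewrite -mulr_suml le_eqVlt; apply/orP; left; apply/eqP; field.
Qed.

Lemma ideal_sum (A I : set (l2 R G -> l2 R G)) (J : Type) (s : seq J)
    (T : J -> l2 R G -> l2 R G) :
  closed_ideal A I -> (forall j, I (T j)) -> I (\sum_(j <- s) T j).
Proof.
move=> [_ I0 Ilin _ _] IT; elim: s => [|j s IHs]; first by rewrite big_nil.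
by rewrite big_cons -[T j]scale1r; exact: Ilin.
Qed.

Lemma idealZ (A I : set (l2 R G -> l2 R G)) c T :
  closed_ideal A I -> I T -> I (c *: T).
Proof. by case=> [_ I0 Ilin _ _] IT; rewrite -[_ *: _]addr0; exact: Ilin. Qed.

Lemma ideal_average (I : set (l2 R G -> l2 R G)) n g T :
  closed_ideal (@Cstar_red R G) I -> I T -> I (average n g T).
Proof.
move=> cI IT; apply: (idealZ _ cI); apply: (ideal_sum _ cI) => i.
case: cI => _ _ _ Imul _.
apply: (proj2 (Imul _ _ (Cstar_red_lreg _) _)).
exact: (proj1 (Imul _ _ (Cstar_red_lreg _) _)).
Qed.

Lemma linear_id : linear (@id (l2 R G)).
Proof. by []. Qed.

(** If [T0'] is in the ideal and [c] is its coefficient at 1, the averages of [T0'],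
    divided by [c], converge to the identity: write [T0'] as a small operator plus
    [a *: id] plus a finite combination [V'] of nontrivial translations, with [a]
    close to [c]. *)
Theorem powers_Cstar_simple : powers_property G -> Cstar_simple R G.
Proof.
move=> powG I cI; have [IA I0 Ilin Imul Icl] := cI.
have [[T [IT T0]]|noT] := pselect (exists T, I T /\ T <> 0); last first.
  left; apply/seteqP; split => [T IT|T -> //] /=.
  by apply: contrapT => T0; apply: noT; exists T.
right; suff I1 : I id.
  apply/seteqP; split => // U AU.
  exact: (proj1 (Imul U id AU I1)).
have [h Th] : exists h, T delta h <> 0.
  apply: contrapT => nh; apply: T0; apply: Cstar_red_eq0 (IA _ IT) _ => h.
  by apply: contrapT => Th; apply: nh; exists h.
pose T0' := lreg h^-1%g \o T.
have IT0 : I T0' by exact: (proj1 (Imul _ _ (Cstar_red_lreg _) IT)).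
pose c := T0' delta 1%g.
have c0 : c != 0.
  by apply/eqP; rewrite /c /T0' /= invgK mulg1.
clearbody T0'; clear T IT T0 h Th.
apply: Icl; split; first exact: gain_bounded ler01 linear_id gain_id.
move=> e e0.
have nc0 : 0 < normc c.
  rewrite lt_def normc_ge0 andbT; apply/eqP => /eq0_normc/eqP.
  by rewrite (negbTE c0).
(* The three parts below add up to the squared bound [10 * (e / 8) ^ 2]. *)
pose eta := e * normc c / 8.
have eta0 : 0 < eta by rewrite /eta !mulr_gt0 // invr_gt0.
have [V gV gTV] := approx (IA _ IT0) eta0.
have [s [d [us VE]]] := group_ops_uniq gV.
pose a := V delta 1%g.
have ca : normc (c - a) ^+ 2 <= eta ^+ 2.
  have := normc_le_gain delta 1%g gTV; rewrite fine_sqsum_delta mulr1.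
  by rewrite [(T0' - V) delta 1%g](_ : _ = c - a).
pose s' := [seq g <- s | g != 1%g].
pose V' := \sum_(g <- s') d g *: @lreg R G g.
have VE' : V = a *: id + V'.
  rewrite {1}VE /V' big_filter (bigID (fun g => g == 1%g)) /=; congr (_ + _).
  rewrite /a VE group_op_delta // -big_filter.
  case: ifPn => s1.
    by rewrite filter_pred1_uniq // big_seq1 lreg1.
  rewrite scale0r big1_seq // => g; rewrite mem_filter => /andP[_].
  by case/andP => /eqP ->; rewrite (negbTE s1).
have [C [g [sC gC]]] : exists (C : G -> Prop) (g : nat -> G),
    (forall x h, x \in s' -> C h -> ~ C (x * h)%g) /\
    (forall i j h, i <> j -> C ((g i)^-1 * h)%g \/ C ((g j)^-1 * h)%g).
  by apply: powG; rewrite mem_filter eqxx.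
pose M := 4 * (size s')%:R * (\sum_(h <- s') normc (d h) ^+ 2).
have [n n0 nM] : exists2 n, (0 < n)%N & M / n%:R <= eta ^+ 2.
  exists (Num.bound (M / eta ^+ 2)).+1 => //.
  rewrite ler_pdivrMr ?ltr0n // mulrC -ler_pdivrMr ?exprn_gt0 //.
  apply: le_trans (ltW (archi_boundP _)) _; last by rewrite ler_nat.
  rewrite divr_ge0 ?sqr_ge0 // mulr_ge0 // sumr_ge0 // => ? _; exact: sqr_ge0.
exists (c^-1 *: average n g T0'); first exact: idealZ cI (ideal_average n g cI IT0).
have -> : id - c^-1 *: average n g T0' =
   c^-1 *: (((c - a) *: id - average n g V') - average n g (T0' - V)).
  have TE : T0' = (T0' - V) + (a *: id + V') by rewrite -VE' subrK.
  rewrite {1}TE !averageD average_scalar //.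
  set X := average _ _ _; set Y := average _ _ V'.
  have {1}-> : id = c^-1 *: (c *: id) :> (l2 R G -> l2 R G).
    by rewrite scalerA mulVf // scale1r.
  rewrite -scalerBr scalerBl; congr (_ *: _); rewrite !opprD.
  by rewrite addrCA addrC !addrA.
apply: (@le_lt_trans _ _ (e / 2)%:E); last by rewrite lte_fin; lra.
apply: opnorm_le; first by lra.
have gY : gain (eta ^+ 2) (- average n g V').
  by apply: gain_le nM _; apply: gainN; exact: gain_average_group_op sC gC n0.
have gX : gain (eta ^+ 2) (- average n g (T0' - V)).
  by apply: gainN; exact: gain_average.
have gid : gain (eta ^+ 2) ((c - a) *: (@id (l2 R G))).
  by apply: (gain_le ca); rewrite -[_ ^+ 2]mulr1; exact: gainZ gain_id.
apply: gain_le (gainZ _ (gainD (gainD gid gY) gX)).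
rewrite normcV exprVn /eta; set x := normc c in nc0 *.
rewrite -subr_ge0; set q := (X in 0 <= X).
have -> : q = e ^+ 2 * (3 / 32) by rewrite /q; field; lra.
by rewrite mulr_ge0 ?sqr_ge0 //; lra.
Qed.

End PowersSimple.

(** * Cosets of a line in the lattice *)

Notation lattice := (int * int)%type.
Notation letter := (bool * bool)%type.

(** A coordinate of [w] that is not 0 suffices to choose representatives modulo the
    line spanned by [w]: [rem w a] is constant on cosets of this line, with
    [a = rem w a + w *~ quo w a]. *)
Definition quo (w a : lattice) : int :=
  if w.1 != 0 then (a.1 %/ w.1)%Z else (a.2 %/ w.2)%Z.
Definition rem (w a : lattice) : lattice := a - w *~ quo w a.

Arguments quo : simpl never.
Arguments rem : simpl never.

Lemma latticeMz (w : lattice) (c : int) : w *~ c = (w.1 * c, w.2 * c).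
Proof.
rewrite [LHS]surjective_pairing; congr (_, _).
  by rewrite (raddfMz (@fst int int)) mulrzz.
by rewrite (raddfMz (@snd int int)) mulrzz.
Qed.

Lemma lattice_neq0 (w : lattice) : w <> 0 -> w.1 <> 0 \/ w.2 <> 0.
Proof.
case: w => m n w0; have [m0|/eqP] := eqVneq m 0; last by left.
by right => /= n0; apply: w0; rewrite m0 n0.
Qed.

Lemma quoDMz (w a : lattice) (c : int) : w <> 0 -> quo w (a + w *~ c) = quo w a + c.
Proof.
move=> /lattice_neq0 w0; rewrite /quo latticeMz /=.
case: eqP => /= w1; rewrite addrC [_ * c]mulrC divzMDl 1?addrC //; apply/eqP => //.
by case: w0.
Qed.

Lemma quo0 (w : lattice) : quo w 0 = 0.
Proof. by rewrite /quo; case: ifP; rewrite div0z. Qed.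

Lemma quoMz (w : lattice) (c : int) : w <> 0 -> quo w (w *~ c) = c.
Proof. by move=> w0; rewrite -[w *~ c]add0r quoDMz // quo0 add0r. Qed.

Lemma latticeMz_eq0 (w : lattice) (c : int) : w <> 0 -> w *~ c = 0 -> c = 0.
Proof. by move=> w0 wc; rewrite -(quoMz c w0) wc quo0. Qed.

(** The letter [(i, b)] stands for the [i]-th stable letter, inverted if [b]. *)
Definition linv (s : letter) : letter := (s.1, ~~ s.2).

Lemma linvK : involutive linv.
Proof. by case=> i b; rewrite /linv /= negbK. Qed.

Lemma linv_neq s : linv s != s.
Proof. by case: s => [[] []]. Qed.

(** Two stable generators give four directions at a vertex, enough to branch away
    from two given ones. *)
Lemma letter_avoid (s s' : letter) : exists l : letter, l != s /\ l != s'.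
Proof.
case: s s' => [[] []] [[] []];
  solve [by exists (true, true) | by exists (true, false) | by exists (false, true)].
Qed.

Section Tree.
Variable v : letter -> lattice.
Hypothesis v0 : forall s, v s <> 0.
Implicit Types (a b r : lattice) (s l : letter) (o : option letter).
Implicit Types L w z : seq (lattice * letter).

(** The action of a lattice element on vertices.  Multiplying [r s ...] by [a] on the
    left leaves the representative of [a + r], and the remaining multiple of [v s]
    crosses the letter [s] as the same multiple of [v (linv s)]. *)
Fixpoint shift a L : seq (lattice * letter) :=
  if L is (r, s) :: L' then
    (rem (v s) (a + r), s) :: shift (v (linv s) *~ quo (v s) (a + r)) L'
  else [::].

Fixpoint residue a L : lattice :=
  if L is (r, s) :: L' then residue (v (linv s) *~ quo (v s) (a + r)) L' else a.

(** The option is the letter that precedes the list, so that reducedness of a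
    concatenation splits ([reduced_cat]). *)
Fixpoint reduced o L : bool :=
  if L is (r, s) :: L' then
    [&& quo (v s) r == 0, (r == 0) ==> (o != Some (linv s)) & reduced (Some s) L']
  else true.

Fixpoint end_letter o L : option letter :=
  if L is (r, s) :: L' then end_letter (Some s) L' else o.

Definition push s L : seq (lattice * letter) :=
  if L is (r, s') :: L' then
    if (r == 0) && (s' == linv s) then L' else (0, s) :: L
  else [:: (0, s)].

(** Lattice elements that arrive after a letter [s] are multiples of [v (linv s)], and
    only those preserve lists that are reduced after [s]. *)
Definition absorbs o a := forall s, o = Some s -> exists c, a = v (linv s) *~ c.

Lemma reduced_cat o w z :
  reduced o (w ++ z) = reduced o w && reduced (end_letter o w) z.
Proof. by elim: w o => [|[r s] w IHw] o //=; rewrite IHw !andbA. Qed.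

Lemma end_letter_cat o w z : end_letter o (w ++ z) = end_letter (end_letter o w) z.
Proof. by elim: w o => [|[r s] w IHw] o //=. Qed.

Lemma end_letter_shift o a L : end_letter o (shift a L) = end_letter o L.
Proof. by elim: L o a => [|[r s] L IHL] o a //=. Qed.

Lemma size_shift a L : size (shift a L) = size L.
Proof. by elim: L a => [|[r s] L IHL] a //=; rewrite IHL. Qed.

Lemma shift_cat a w z : shift a (w ++ z) = shift a w ++ shift (residue a w) z.
Proof. by elim: w a => [|[r s] w IHw] a //=; rewrite IHw. Qed.

Lemma quo_rem_add s a b :
  quo (v s) (b + rem (v s) a) = quo (v s) (b + a) - quo (v s) a.
Proof. by rewrite /rem addrA -mulrNz quoDMz. Qed.

Lemma rem_rem_add s a b : rem (v s) (b + rem (v s) a) = rem (v s) (b + a).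
Proof.
rewrite [LHS]/rem quo_rem_add /rem mulrzBr opprB !addrA.
by rewrite subrK.
Qed.

Lemma shiftD a b L : shift a (shift b L) = shift (a + b) L.
Proof.
elim: L a b => [|[r s] L IHL] a b //=.
by rewrite IHL rem_rem_add quo_rem_add -mulrzDr subrK !addrA.
Qed.

Lemma shift0 o L : reduced o L -> shift 0 L = L.
Proof.
elim: L o => [|[r s] L IHL] o //= /and3P[/eqP qr _ rL].
by rewrite /rem add0r qr mulr0z subr0 (IHL _ rL).
Qed.

Lemma reduced_shift o a L : absorbs o a -> reduced o L -> reduced o (shift a L).
Proof.
elim: L o a => [|[r s] L IHL] o a //= oa /and3P[/eqP qr rb rL]; apply/and3P; split.
- by rewrite -[rem _ _]add0r quo_rem_add add0r subrr.
- apply/implyP => rem0; apply/eqP => os; have [c ac] := oa _ os.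
  rewrite linvK in ac; move: rb; rewrite os eqxx /= implybF => /eqP; apply.
  by move: rem0; rewrite /rem ac [_ + r]addrC quoDMz // qr add0r addrK => /eqP.
- by apply: IHL => // s' [<-]; eexists.
Qed.

Lemma absorbs_residue o a L : absorbs o a -> absorbs (end_letter o L) (residue a L).
Proof.
elim: L o a => [|[r s] L IHL] o a //= oa.
by apply: IHL => s' [<-]; eexists.
Qed.

Lemma absorbsD o a b : absorbs o a -> absorbs o b -> absorbs o (a + b).
Proof.
move=> oa ob s os; have [c ->] := oa s os; have [d ->] := ob s os.
by exists (c + d); rewrite mulrzDr.
Qed.

Lemma absorbs0 o : absorbs o 0.
Proof. by move=> s _; exists 0; rewrite mulr0z. Qed.

Lemma absorbsN o a : absorbs o a -> absorbs o (- a).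
Proof. by move=> oa s /oa[c ->]; exists (- c); rewrite mulrNz. Qed.

Lemma reduced_None o L : reduced o L -> reduced None L.
Proof. by case: L => [|[r s] L] //= /and3P[-> _ ->]; rewrite implybT. Qed.

Lemma reduced_cons0 o s L : o != Some (linv s) -> reduced (Some s) L ->
  reduced o ((0, s) :: L).
Proof. by move=> os rL; rewrite /= quo0 eqxx os rL. Qed.

Lemma reduced_push s L : reduced None L -> reduced None (push s L).
Proof.
case: L => [|[r s'] L] /= rL; first by rewrite quo0.
case: ifPn => rs; first by case/and3P: rL => _ _ /reduced_None.
apply: reduced_cons0 => //=; case/and3P: rL => -> _ ->; rewrite andbT /=.
apply/implyP => r0; rewrite r0 /= in rs; apply: contra rs => /eqP[->].
by rewrite linvK.
Qed.

Lemma pushK s L : reduced None L -> push (linv s) (push s L) = L.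
Proof.
case: L => [|[r s'] L] /= rL; first by rewrite linvK !eqxx.
move: rL; case: ifP => [/andP[/eqP-> /eqP->] rL|_ _]; last by rewrite /= linvK !eqxx.
case/and3P: rL => _ _; case: L => [|[r2 s2] L] //= /and3P[_ H _].
case: ifP => // /andP[/eqP r20 /eqP ss]; move: H.
by rewrite r20 ss linvK !eqxx.
Qed.

(** The [c]-th power of the defining relation of [s], read on vertices. *)
Lemma shift_push s c L : reduced None L ->
  shift (v s *~ c) (push s L) = push s (shift (v (linv s) *~ c) L).
Proof.
case: L => [|[r s'] L] /= rL; first by rewrite /rem addr0 quoMz // subrr.
case/and3P: rL => /eqP qr _ rL.
have [ss|ss] := eqVneq s' (linv s); last first.
  by rewrite !andbF /= /rem addr0 quoMz // subrr.
have E : rem (v s') (v (linv s) *~ c + r) = r.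
  by rewrite /rem ss [_ + r]addrC quoDMz // -ss qr add0r addrK.
rewrite E !andbT; case: eqP => [->|_].
  by rewrite addr0 ss quoMz // linvK.
by rewrite /= addr0 quoMz // [rem (v s) _]/rem quoMz // subrr E.
Qed.

Lemma shift_cat_neq a t z z' : shift a t != t -> shift a (t ++ z) <> t ++ z'.
Proof.
move=> at_neq; rewrite shift_cat => /eqP; rewrite eqseq_cat ?size_shift //.
by rewrite (negbTE at_neq).
Qed.

Lemma rem_quo s a : a = rem (v s) a + v s *~ quo (v s) a.
Proof. by rewrite subrK. Qed.

Lemma rem0E s a : rem (v s) a = 0 -> a = v s *~ quo (v s) a.
Proof. by move=> a0; rewrite {1}(rem_quo s a) a0 add0r. Qed.

Definition contracting s : Prop :=
  (`|(v (linv s)).1| < `|(v s).1|) \/ (`|(v (linv s)).2| < `|(v s).2|).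

Section Mover.
Variable s0 : letter.
Hypothesis shrink : contracting s0.

(** The coordinate that shrinks makes the multiplier shrink too. *)
Lemma shrink_quo c d : c <> 0 -> v (linv s0) *~ c = v s0 *~ d -> (`|d| < `|c|)%N.
Proof.
rewrite !latticeMz; move: shrink; rewrite /contracting.
case: (v (linv s0)) => m' n'; case: (v s0) => m n /= sh c0 [E1 E2].
have {}E1 : `|m'| * `|c| = `|m| * `|d| by rewrite -!normrM E1.
have {}E2 : `|n'| * `|c| = `|n| * `|d| by rewrite -!normrM E2.
rewrite ltnNge; apply/negP => cd.
have cd' : `|c| <= `|d| :> int by lia.
have c1 : 0 < `|c| :> int by lia.
by case: sh => sh; nia.
Qed.

Lemma reduced_nseq o n : o != Some (linv s0) -> reduced o (nseq n (0, s0)).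
Proof.
elim: n o => //= n IHn o os; rewrite quo0 eqxx os /=.
by apply: IHn; case: s0 => [[] []].
Qed.

(** Descent on [|quo (v s0) a|]: while the path is fixed, each letter replaces this
    positive integer by a smaller one. *)
Lemma nseq_moved a : a <> 0 -> exists n, shift a (nseq n (0, s0)) != nseq n (0, s0).
Proof.
have [m am] : exists m, (`|quo (v s0) a| < m)%N by exists (`|quo (v s0) a|).+1.
elim: m a am => // m IHm a am a0.
have [ra|ra] := eqVneq (rem (v s0) a) 0; last first.
  by exists 1%N; rewrite /= addr0 eqseq_cons xpair_eqE (negbTE ra).
set c := quo (v s0) a in am; have ac : a = v s0 *~ c by exact: rem0E.
have c0 : c <> 0 by move=> c0; apply: a0; rewrite ac c0 mulr0z.
have [n nP] : exists n, shift (v (linv s0) *~ c) (nseq n (0, s0)) != nseq n (0, s0).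
  have [rc|rc] := eqVneq (rem (v s0) (v (linv s0) *~ c)) 0; last first.
    by exists 1%N; rewrite /= addr0 eqseq_cons xpair_eqE (negbTE rc).
  apply: IHm.
    apply: leq_trans (ltnSE am); apply: shrink_quo c0 _; exact: rem0E.
  by move=> /(latticeMz_eq0 (@v0 _)).
by exists n.+1; rewrite /= addr0 -/c eqseq_cons (negbTE nP) andbF.
Qed.

(** If [s0] would backtrack after [s], a letter of the other stable generator is put
    in between; it either moves already or carries [a] to another nonzero element. *)
Lemma moved_extension s a : a <> 0 ->
  exists t, reduced (Some s) t /\ shift a t != t.
Proof.
move=> a0; have [ss|ss] := eqVneq s (linv s0); last first.
  have [n nP] := nseq_moved a0; exists (nseq n (0, s0)); split => //.
  exact: reduced_nseq.
have [l [ls ls0]] := letter_avoid s (linv s).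
have [ra|ra] := eqVneq (rem (v l) a) 0; last first.
  exists [:: (0, l)]; split.
    by rewrite /= quo0 !andbT /=; apply: contra ls0 => /eqP[->]; rewrite linvK.
  by rewrite /= addr0 eqseq_cons xpair_eqE (negbTE ra).
set c := quo (v l) a; have ac : a = v l *~ c by exact: rem0E.
have c0 : c <> 0 by move=> c0; apply: a0; rewrite ac c0 mulr0z.
have [n nP] : exists n, shift (v (linv l) *~ c) (nseq n (0, s0)) != nseq n (0, s0).
  by apply: nseq_moved => /(latticeMz_eq0 (@v0 _)).
exists ((0, l) :: nseq n (0, s0)); split.
  apply: reduced_cons0; first by apply: contra ls0 => /eqP[->]; rewrite linvK.
  by apply: reduced_nseq; rewrite -ss; apply: contra ls => /eqP[->].
by rewrite /= addr0 -/c eqseq_cons (negbTE nP) andbF.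
Qed.

End Mover.

(** A vector orthogonal to [w] has infinite order modulo the line of [w]. *)
Lemma latticeMz_orthogonal (w : lattice) (c d : int) : w <> 0 ->
  (- w.2, w.1) *~ c = w *~ d -> c = 0.
Proof.
move=> /lattice_neq0; rewrite !latticeMz; case: w => m n /= w0 [E1 E2].
have /eqP : c * (m * m + n * n) = 0.
  have -> : c * (m * m + n * n) = m * (m * c) - n * (- n * c) by ring.
  by rewrite E1 E2; ring.
rewrite mulf_eq0 => /orP[/eqP //|/eqP E]; nia.
Qed.

End Tree.

(** * Integer powers in a group *)

Section IntegerPowers.
Context {G : groupType}.
Local Open Scope group_scope.

Definition zexp (g : G) (n : int) : G :=
  match n with Posz k => g ^+ k | Negz k => g^-1 ^+ k.+1 end.

Lemma zexpS g n : zexp g (n + 1)%R = zexp g n * g.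
Proof.
case: n => [k|[|k]].
- by rewrite -PoszD addn1 /= expgSr.
- by rewrite /= mulVg.
have -> : (Negz k.+1 + 1)%R = Negz k by lia.
by rewrite /= [in RHS]expgSr mulgVK.
Qed.

Lemma zexpB1 g n : zexp g (n - 1)%R = zexp g n * g^-1.
Proof. by rewrite -{2}[n](subrK 1%R) zexpS mulgK. Qed.

Lemma zexpD g m n : zexp g (m + n)%R = zexp g m * zexp g n.
Proof.
elim/int_rect: n => [|n IHn|n IHn]; first by rewrite addr0 mulg1.
  rewrite -addn1 PoszD addrA !zexpS IHn mulgA //.
rewrite -addn1 PoszD opprD addrA !zexpB1 IHn mulgA //.
Qed.

Lemma zexp_conj (x y t : G) n : x * t = t * y -> zexp x n * t = t * zexp y n.
Proof.
move=> xt; elim/int_rect: n => [|n IHn|n IHn]; first by rewrite mulg1 mul1g.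
  by rewrite -addn1 PoszD !zexpS -mulgA xt !mulgA IHn.
rewrite -addn1 PoszD opprD !zexpB1.
have xt' : x^-1 * t = t * y^-1.
  by apply: (mulgI x); apply: (mulIg y); rewrite mulVKg -!mulgA mulVg mulg1.
by rewrite -mulgA xt' !mulgA IHn.
Qed.

Lemma zexp_commute (x y : G) m n :
  x * y = y * x -> zexp x m * zexp y n = zexp y n * zexp x m.
Proof. by move=> xy; apply: zexp_conj; apply/esym/zexp_conj. Qed.

End IntegerPowers.

Section TwoStableGroup.
Variables mn1 mn2 kl1 kl2 : lattice.
Hypothesis mn1_neq0 : mn1 <> 0.
Hypothesis mn2_neq0 : mn2 <> 0.
Hypothesis kl1_neq0 : kl1 <> 0.
Hypothesis kl2_neq0 : kl2 <> 0.

Definition edge_vec (s : letter) : lattice :=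
  if s.1 then (if s.2 then kl2 else kl1) else (if s.2 then mn2 else mn1).
Local Notation v := edge_vec.

Lemma edge_vec_neq0 s : v s <> 0.
Proof. by case: s => [[] []]. Qed.
Local Notation v0 := edge_vec_neq0.

Local Notation rels := (two_stable_rels mn1 mn2 kl1 kl2).
Local Notation G := (two_stable_group mn1 mn2 kl1 kl2).
Local Notation cls u := (pres_class rels u : G).

Definition stable (s : letter) : 'I_4 * bool := (if s.1 then gy else gx, s.2).

Definition gen_act (t : 'I_4 * bool) (L : seq (lattice * letter)) :=
  if t.1 == ga then shift v (if t.2 then (-1, 0) else (1, 0)) L
  else if t.1 == gb then shift v (if t.2 then (0, -1) else (0, 1)) L
  else push (t.1 == gy, t.2) L.

Definition wact (u : word 'I_4) L := foldr gen_act L u.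

Lemma wact_cat u u' L : wact (u ++ u') L = wact u (wact u' L).
Proof. exact: foldr_cat. Qed.

Lemma gen_act_stable s L : gen_act (stable s) L = push s L.
Proof. by case: s => [[] b]. Qed.

Lemma reduced_gen_act t L : reduced v None L -> reduced v None (gen_act t L).
Proof.
move=> rL; rewrite /gen_act; case: ifP => _; last case: ifP => _.
- exact: (reduced_shift v0).
- exact: (reduced_shift v0).
- exact: reduced_push.
Qed.

Lemma reduced_wact u L : reduced v None L -> reduced v None (wact u L).
Proof. by move=> rL; elim: u => //= t u; exact: reduced_gen_act. Qed.

Lemma wact_wexp (t : 'I_4) (e : lattice) n L :
  (forall L, gen_act (t, false) L = shift v e L) ->
  (forall L, gen_act (t, true) L = shift v (- e) L) ->
  reduced v None L -> wact (wexp t n) L = shift v (e *~ n) L.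
Proof.
move=> tF tT rL.
have nat_case (b : bool) e' k : (forall L, gen_act (t, b) L = shift v e' L) ->
    wact (nseq k (t, b)) L = shift v (e' *+ k) L.
  move=> tb; elim: k => [|k IHk] /=; first by rewrite (shift0 rL).
  by rewrite tb -/(wact _ _) IHk (shiftD v0) mulrS.
case: n => k; first exact: nat_case tF.
by rewrite [LHS](nat_case true _ _ tT) NegzE mulrNz mulNrn.
Qed.

Lemma wact_ab u L : reduced v None L -> wact (ab_word u) L = shift v u L.
Proof.
move=> rL; rewrite wact_cat.
have -> : wact (wexp gb u.2) L = shift v ((0, 1) *~ u.2) L by exact: wact_wexp.
have -> : wact (wexp ga u.1) (shift v ((0, 1) *~ u.2) L) =
    shift v ((1, 0) *~ u.1) (shift v ((0, 1) *~ u.2) L).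
  by apply: wact_wexp => //; exact: (reduced_shift v0).
rewrite (shiftD v0); congr (shift _ _ _); case: u => m n; rewrite !latticeMz /=.
by congr (_, _); rewrite ?mul0r ?mul1r ?addr0 ?add0r.
Qed.

Lemma wact_conj s L : reduced v None L ->
  push (linv s) (shift v (v s) (push s L)) = shift v (v (linv s)) L.
Proof.
move=> rL; have := shift_push v0 s 1 rL; rewrite !mulr1z => ->.
by apply: (pushK (v := v)); exact: (reduced_shift v0).
Qed.

(** The action of words on reduced lists factors through the group. *)
Lemma wact_rel u u' L : pres_eq rels u u' -> reduced v None L ->
  wact u L = wact u' L.
Proof.
move=> uu; elim: uu L => {u u'}.
- move=> u u'; rewrite !inE !xpair_eqE => /or3P[] /andP[/eqP-> /eqP->] L rL.
  + rewrite /= /gen_act /= !(shiftD v0); exact: (shift0 rL).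
  + rewrite /conj_word 2!wact_cat !wact_ab ?reduced_wact //.
    exact: (wact_conj (false, false) rL).
  + rewrite /conj_word 2!wact_cat !wact_ab ?reduced_wact //.
    exact: (wact_conj (true, false) rL).
- move=> t b L rL; rewrite /= /gen_act /=.
  case: (t == ga) => /=; last case: (t == gb) => /=.
  + by rewrite (shiftD v0); case: b; exact: (shift0 rL).
  + by rewrite (shiftD v0); case: b; exact: (shift0 rL).
  + have := @pushK v (t == gy, ~~ b) L rL.
    by rewrite {1}/linv /= negbK.
- by move=> u u' w w' _ IHu _ IHw L rL; rewrite !wact_cat IHw // IHu // reduced_wact.
- by [].
- by move=> u u' _ IH L rL; rewrite IH.
- by move=> u w w' _ IH1 _ IH2 L rL; rewrite IH1 // IH2.
Qed.

Definition gact (g : G) L := wact (pres_repr g) L.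

Lemma gact_cls u L : reduced v None L -> gact (cls u) L = wact u L.
Proof. by move=> rL; apply: wact_rel rL; exact: pres_reprP. Qed.

Lemma reduced_gact g L : reduced v None L -> reduced v None (gact g L).
Proof. exact: reduced_wact. Qed.

Lemma clsM u u' : (cls u * cls u')%g = cls (u ++ u').
Proof. exact: pres_mulE. Qed.

Lemma gactM (g h : G) L : reduced v None L -> gact (g * h)%g L = gact g (gact h L).
Proof.
move=> rL; rewrite -[g in LHS]pres_reprK -[h in LHS]pres_reprK clsM gact_cls //.
by rewrite wact_cat.
Qed.

Lemma gact1 L : reduced v None L -> gact 1%g L = L.
Proof. exact: (@gact_cls [::]). Qed.

Definition lattice_elt (a : lattice) : G := cls (ab_word a).
Definition stable_elt (s : letter) : G := cls [:: stable s].

Lemma cls_wexp (t : 'I_4) n : cls (wexp t n) = zexp (cls [:: (t, false)]) n.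
Proof.
case: n => k /=.
  elim: k => // k IHk; rewrite expgS -IHk clsM //.
have -> : (cls [:: (t, false)])^-1%g = cls [:: (t, true)].
  exact: pres_invE.
elim: k => // k IHk; rewrite expgS -IHk clsM //.
Qed.

Lemma gen_commute : (cls [:: (ga, false)] * cls [:: (gb, false)] =
  cls [:: (gb, false)] * cls [:: (ga, false)])%g.
Proof.
have H : cls (wexp ga (-1) ++ wexp gb (-1) ++ wexp ga 1 ++ wexp gb 1) = 1%g.
  by apply/pres_classP/pres_rel; rewrite !inE eqxx.
move: H; rewrite -!clsM !cls_wexp /= !mulgA -invgM -mulgA.
by move/mulg1_eq; rewrite invgK.
Qed.

Lemma lattice_eltD a b : lattice_elt (a + b) = (lattice_elt a * lattice_elt b)%g.
Proof.
rewrite /lattice_elt /ab_word -!clsM !cls_wexp !zexpD -!mulgA; congr (_ * _)%g.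
by rewrite !mulgA; congr (_ * _)%g; apply: zexp_commute; exact: gen_commute.
Qed.

Lemma lattice_elt0 : lattice_elt 0 = 1%g.
Proof. by []. Qed.

Lemma lattice_eltN a : lattice_elt (- a) = (lattice_elt a)^-1%g.
Proof. by apply: (mulgI (lattice_elt a)); rewrite -lattice_eltD subrr mulgV. Qed.

Lemma lattice_eltMz a c : lattice_elt (a *~ c) = zexp (lattice_elt a) c.
Proof.
elim/int_rect: c => [|n IHn|n IHn] //.
  by rewrite -addn1 PoszD zexpS mulrzDr lattice_eltD IHn.
by rewrite -addn1 PoszD opprD zexpB1 mulrzDr lattice_eltD IHn mulrN1z lattice_eltN.
Qed.

Lemma stable_elt_inv s : stable_elt (linv s) = (stable_elt s)^-1%g.
Proof. by apply/esym/pres_invE. Qed.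

Lemma lattice_stable_elt s c :
  (lattice_elt (v s *~ c) * stable_elt s =
   stable_elt s * lattice_elt (v (linv s) *~ c))%g.
Proof.
rewrite !lattice_eltMz; apply: zexp_conj.
have base i : (lattice_elt (v (i, false)) * stable_elt (i, false))%g =
    (stable_elt (i, false) * lattice_elt (v (i, true)))%g.
  have E : cls (conj_word (stable (i, false)).1 (ab_word (v (i, false)))) =
      lattice_elt (v (i, true)).
    by apply/pres_classP/pres_rel; rewrite !inE; case: i; rewrite eqxx ?orbT.
  rewrite -E /conj_word -[cls _]clsM -[X in (_ * (_ * X))%g]clsM.
  by rewrite [X in (_ * (X * _))%g](stable_elt_inv (i, false)) mulVKg.
case: s => i [] //; rewrite /linv /=.
have -> : stable_elt (i, true) = (stable_elt (i, false))^-1%g.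
  by rewrite -stable_elt_inv.
apply: (mulgI (stable_elt (i, false))); rewrite mulVKg mulgA -base.
by rewrite mulgK.
Qed.

Fixpoint path_elt (L : seq (lattice * letter)) : G :=
  (if L is (r, s) :: L' then lattice_elt r * stable_elt s * path_elt L' else 1)%g.

Lemma path_elt_cat w z : path_elt (w ++ z) = (path_elt w * path_elt z)%g.
Proof. by elim: w => [|[r s] w IHw] /=; rewrite ?mul1g // IHw !mulgA. Qed.

(** The identity in the group behind [shift] and [residue]. *)
Lemma lattice_path_elt a L :
  (lattice_elt a * path_elt L =
   path_elt (shift v a L) * lattice_elt (residue v a L))%g.
Proof.
elim: L a => [|[r s] L IHL] a /=; first by rewrite mulg1 mul1g.
rewrite -[RHS]mulgA -IHL -[in RHS]mulgA [(stable_elt s * (_ * _))%g in RHS]mulgA.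
rewrite -lattice_stable_elt.
by rewrite !mulgA -!lattice_eltD -(rem_quo v).
Qed.

Lemma gact_lattice_elt a L :
  reduced v None L -> gact (lattice_elt a) L = shift v a L.
Proof. by move=> rL; rewrite gact_cls // wact_ab. Qed.

Lemma gact_stable_elt s L : reduced v None L -> gact (stable_elt s) L = push s L.
Proof. by move=> rL; rewrite gact_cls //= gen_act_stable. Qed.

(** No cancellation occurs along [w]; hence the reduced lists form a single orbit,
    that of the empty list. *)
Lemma gact_path_elt w z : reduced v None (w ++ z) -> gact (path_elt w) z = w ++ z.
Proof.
elim: w => [|[r s] w IHw] /= rz; first exact: gact1.
case/and3P: rz => qr _ rz; have rz' := reduced_None rz.
have rz0 : reduced v None z.
  by move: rz; rewrite reduced_cat => /andP[_ /reduced_None].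
rewrite gactM // IHw // gactM // gact_stable_elt //.
have -> : push s (w ++ z) = (0, s) :: (w ++ z).
  case: (w ++ z) rz => [//|[r' s'] L] /= /and3P[_ H _].
  case: ifP => // /andP[r0 /eqP ss].
  by move: H; rewrite r0 ss linvK eqxx.
rewrite gact_lattice_elt; last by apply: reduced_cons0.
by rewrite /= addr0 /rem (eqP qr) !mulr0z subr0 (shift0 rz').
Qed.

(** Vertices forget the lattice part at the end of a group element.  The second
    clause keeps track of it, so that [f] can be recovered from [w], [w'] and [a]. *)
Definition carries (f : G) w w' a :=
  (forall z, reduced v None (w ++ z) -> gact f (w ++ z) = w' ++ shift v a z) /\
  (f * path_elt w = path_elt w' * lattice_elt a)%g.

(** The conditions under which [w'] can be extended in exactly the ways in which [w]
    can, after the twist by [a]. *)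
Definition coterminal w w' a := exists s,
  [/\ end_letter None w = Some s, end_letter None w' = Some s,
      reduced v None w' & absorbs v (Some s) a].

(** A stable letter may cancel the first letter of [w]; appending the last letter of
    [w] once more keeps the image nonempty in that case. *)
Lemma carries_letter (t : 'I_4 * bool) w s :
  reduced v None w -> end_letter None w = Some s ->
  exists e w' a, [/\ reduced v None (w ++ e), coterminal (w ++ e) w' a &
    carries (cls [:: t]) (w ++ e) w' a].
Proof.
move=> rw ws.
have lat b : cls [:: t] = lattice_elt b -> exists e w' a, [/\ reduced v None (w ++ e),
    coterminal (w ++ e) w' a & carries (cls [:: t]) (w ++ e) w' a].
  move=> tb; exists [::], (shift v b w), (residue v b w); rewrite cats0; split => //.
    exists s; split; rewrite ?end_letter_shift //; first exact: (reduced_shift v0).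
    by rewrite -ws; exact: absorbs_residue.
  by rewrite tb; split => [z rz|]; rewrite ?gact_lattice_elt ?shift_cat ?lattice_path_elt.
have [t1|t1] := eqVneq t.1 ga.
  apply: (lat (if t.2 then (-1, 0) else (1, 0))).
  by case: t t1 {lat} => t [] /= ->.
have [t2|t2] := eqVneq t.1 gb.
  apply: (lat (if t.2 then (0, -1) else (0, 1))).
  by case: t t2 {lat t1} => t [] /= ->.
clear lat; pose l := (t.1 == gy, t.2).
have tl : cls [:: t] = stable_elt l.
  congr (cls [:: _]); rewrite /l; case: t t1 t2 {l} => t b /=.
  rewrite /stable /=; have [->//|] := eqVneq t gy; rewrite -!val_eqE /= => ty ta tb.
  congr (_, _); apply: val_inj => /=.
  by case: t ty ta tb => -[|[|[|[|]]]].
exists [:: (0, s)].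
have re : reduced v None (w ++ [:: (0, s)]).
  rewrite reduced_cat rw ws; apply: reduced_cons0 => //.
  by rewrite (inj_eq Some_inj) eq_sym linv_neq.
have tailz z : reduced v None ((w ++ [:: (0, s)]) ++ z) -> reduced v (Some s) z.
  by rewrite reduced_cat end_letter_cat => /andP[].
case: w rw ws re tailz => // -[r s'] w rw ws re tailz.
have ew x : end_letter x (w ++ [:: (0, s)]) = Some s by rewrite end_letter_cat.
have [/andP[/eqP r0 /eqP sl]|ncancel] := boolP ((r == 0) && (s' == linv l)).
  exists (w ++ [:: (0, s)]), 0; split => //.
    exists s; split; rewrite ?ew //=; last exact: absorbs0.
    by move: re => /= /and3P[_ _ /reduced_None].
  rewrite tl; split => [z rz|].
    rewrite gact_stable_elt //= r0 sl !eqxx /=; congr (_ ++ _).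
    by rewrite (shift0 (tailz _ rz)).
  by rewrite /= r0 sl lattice_elt0 mul1g mulg1 stable_elt_inv mulVKg.
exists ((0, l) :: (r, s') :: w ++ [:: (0, s)]), 0; split => //.
  exists s; split; rewrite ?ew //=; last exact: absorbs0.
  have := @reduced_push v l _ re; rewrite /= (negbTE ncancel) //.
rewrite tl; split => [z rz|].
  rewrite gact_stable_elt //= (negbTE ncancel); do 2 congr (_ :: _).
  by congr (_ ++ _); rewrite (shift0 (tailz _ rz)).
by rewrite /= lattice_elt0 mul1g mulg1.
Qed.

(** Induction on a word for [f].  An extension [e1] needed by the last letter after
    [u] has acted is pulled back through [a], as [shift (- a) e1]. *)
Lemma carries_exists (f : G) w s : reduced v None w -> end_letter None w = Some s ->
  exists e w' a, [/\ reduced v None (w ++ e), coterminal (w ++ e) w' a &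
    carries f (w ++ e) w' a].
Proof.
move=> rw ws; rewrite -[f]pres_reprK; elim: (pres_repr f) => [|t u].
  exists [::], w, 0; rewrite cats0; split => //.
    by exists s; split => //; exact: absorbs0.
  split => [z rz|]; last by rewrite mul1g mulg1.
  rewrite gact1 // (shift0 (o := Some s)) //.
  by move: rz; rewrite reduced_cat ws => /andP[].
case=> e [w1 [a [re [s1 [es1 ws1 rw1 aa]] [ca ga]]]].
have [e1 [w2 [b [re1 [s2 [es2 ws2 rw2 ba]] [cb gb]]]]] := carries_letter t rw1 ws1.
pose e2 := shift v (- a) e1.
have re2 : reduced v (Some s1) e2.
  apply: (reduced_shift v0); first exact: absorbsN.
  by move: re1; rewrite reduced_cat ws1 => /andP[].
have ae2 : shift v a e2 = e1.
  rewrite (shiftD v0) subrr (shift0 (o := Some s1)) //.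
  by move: re1; rewrite reduced_cat ws1 => /andP[].
have ee2 : end_letter None ((w ++ e) ++ e2) = Some s2.
  by rewrite end_letter_cat es1 end_letter_shift -ws1 -end_letter_cat.
exists (e ++ e2), w2, (b + residue v a e2); rewrite catA; split.
- by rewrite reduced_cat re es1.
- exists s2; split => //; apply: absorbsD => //.
  have -> : Some s2 = end_letter (Some s1) e2 by rewrite -es1 -end_letter_cat.
  exact: absorbs_residue.
rewrite -cat1s -clsM; split => [z rz|].
  have re2z : reduced v (Some s1) (e2 ++ z).
    by move: rz; rewrite -!catA catA reduced_cat es1 => /andP[].
  have rbz : reduced v None ((w1 ++ e1) ++ shift v (residue v a e2) z).
    rewrite -catA reduced_cat ws1 rw1 /= -ae2 -shift_cat.
    exact: (reduced_shift v0).
  rewrite gactM; last by rewrite -!catA catA in rz *; exact: rz.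
  rewrite -catA ca; last by rewrite catA.
  by rewrite shift_cat ae2 catA cb // (shiftD v0).
rewrite path_elt_cat -!mulgA [(cls u * _)%g]mulgA ga -!mulgA lattice_path_elt ae2.
rewrite [(path_elt w1 * _)%g]mulgA -path_elt_cat mulgA gb -mulgA -lattice_eltD //.
Qed.

(** If [w'] and [w] have different lengths, the letter at the end of the shorter one
    can be chosen to differ from the letter of the longer one at that place, and the
    choice is not affected by the lattice action, which preserves letters.  If
    they have equal lengths, the images differ unless [w' = w], which is the case
    of [moved_extension]. *)
Lemma branching (f : G) w s : f != 1%g ->
  (exists s0, contracting v s0) ->
  reduced v None w -> end_letter None w = Some s ->
  exists e s', [/\ reduced v None (w ++ e), end_letter None (w ++ e) = Some s' &
    forall z z', reduced v None ((w ++ e) ++ z) ->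
      gact f ((w ++ e) ++ z) <> (w ++ e) ++ z'].
Proof.
move=> f1 [s0 shrink] rw ws.
have [e [w' [a [re [s1 [es1 ws1 rw1 aa]] [ca ga]]]]] := carries_exists f rw ws.
suff [t [rt tP]] : exists t, reduced v (Some s1) t /\
    forall z z', reduced v None ((w ++ e) ++ t ++ z) ->
      w' ++ shift v a (t ++ z) <> (w ++ e) ++ t ++ z'.
  exists (e ++ t).
  have [s2 es2] : exists s2, end_letter None (w ++ e ++ t) = Some s2.
    rewrite catA end_letter_cat es1; case: (t) => [|[r s'] t'] /=; first by exists s1.
    by elim: t' s' => [|[r2 s2] t' IHt] s' /=; [exists s'|exact: IHt].
  exists s2; split => //; first by rewrite catA reduced_cat re es1.
  move=> z z'; rewrite [w ++ e ++ t]catA -!catA catA => rz.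
  by rewrite ca // catA; exact: tP.
have fork l : l != linv s1 -> reduced v (Some s1) [:: (0, l)].
  move=> ll; apply: reduced_cons0 => //.
  by rewrite (inj_eq Some_inj); apply: contra ll => /eqP ->; rewrite linvK.
have [ltw|ltw|eqw] := ltngtP (size (w ++ e)) (size w').
- have [l [ls lp]] := letter_avoid (linv s1) (nth (0, s1) w' (size (w ++ e))).2.
  exists [:: (0, l)]; split; first exact: fork.
  move=> z z' _ /(congr1 (nth (0, s1)^~ (size (w ++ e)))).
  rewrite nth_cat ltw nth_cat ltnn subnn /= => E.
  by rewrite E eqxx in lp.
- have [l [ls lp]] := letter_avoid (linv s1) (nth (0, s1) (w ++ e) (size w')).2.
  exists [:: (0, l)]; split; first exact: fork.
  move=> z z' _ /(congr1 (nth (0, s1)^~ (size w'))).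
  rewrite nth_cat ltnn subnn [RHS]nth_cat ltw /= => E.
  by rewrite -E eqxx in lp.
- have [wE|wE] := eqVneq w' (w ++ e); last first.
    exists [::]; split => // z z' _ /eqP; rewrite eqseq_cat // (negbTE wE) //.
  have a0 : a <> 0.
    move=> a0; move/eqP: f1; apply; apply: (mulIg (path_elt (w ++ e))).
    by rewrite ga wE a0 lattice_elt0 mulg1 mul1g.
  have [t [rt ta]] := moved_extension v0 shrink s1 a0.
  exists t; split => // z z' _; rewrite wE => /eqP; rewrite eqseq_cat // eqxx /=.
  by move/eqP; exact: shift_cat_neq.
Qed.

(** A subcylinder of a cylinder that [f] moves off itself is also moved off itself,
    so that cylinders for the elements of [F] can be nested. *)
Lemma common_cylinder (F : seq G) :
  (exists s0, contracting v s0) ->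
  1%g \notin F ->
  exists w s, [/\ reduced v None w, end_letter None w = Some s &
    forall f, f \in F ->
    forall z z', reduced v None (w ++ z) -> gact f (w ++ z) <> w ++ z'].
Proof.
move=> shrink; elim: F => [|f F IHF].
  exists [:: (0, (true, true))], (true, true); split => //=.
  by rewrite quo0.
rewrite inE negb_or eq_sym => /andP[f1 /IHF[w [s [rw ws wF]]]].
have [e [s' [re es ef]]] := branching f1 shrink rw ws.
exists (w ++ e), s'; split => // g; rewrite inE => /predU1P[->//|gF] z z'.
by rewrite -!catA; exact: wF.
Qed.

(** The inverse of [w] maps the complement of the cylinder of [w] onto the vertices
    that begin with the last letter of [w] inverted.  A lattice element [q] moves these
    to the vertices beginning with [rem u q], and the multiples of [b], which is
    orthogonal to [u], have distinct representatives. *)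
Lemma two_stable_powers_property :
  (exists s0, contracting v s0) ->
  powers_property G.
Proof.
move=> shrink F F1; have [w [s [rw ws wF]]] := common_cylinder shrink F1.
pose u := v (linv s).
pose b : lattice := (- u.2, u.1).
exists (fun h : G => exists z, gact h [::] = w ++ z).
exists (fun i : nat => (lattice_elt (b *~ i) * (path_elt w)^-1)%g); split.
  move=> f h fF [z hz] [z']; rewrite gactM // hz.
  by apply: wF => //; rewrite -hz; exact: reduced_gact.
move=> i j h ij.
have into (n : nat) : reduced v (Some s) (shift v (- (b *~ n)) (gact h [::])) ->
    exists z, gact ((lattice_elt (b *~ n) * (path_elt w)^-1)^-1 * h)%g [::] = w ++ z.
  move=> rn; exists (shift v (- (b *~ n)) (gact h [::])).
  rewrite invgM invgK -mulgA -lattice_eltN !gactM ?reduced_gact //.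
  rewrite gact_lattice_elt ?reduced_gact // gact_path_elt //.
  by rewrite reduced_cat rw ws.
have [ri|ri] := boolP (reduced v (Some s) (shift v (- (b *~ i)) (gact h [::]))).
  by left; exact: into.
right; apply: into.
have rL : reduced v None (gact h [::]) by exact: reduced_gact.
have rs n : reduced v None (shift v (- (b *~ n)) (gact h [::])).
  exact: (reduced_shift v0).
move: ri (rs i) (rs j); case: (gact h [::]) => [//|[r s'] L] /=.
move=> ri /and3P[qi _ ri'] /and3P[qj _ rj']; rewrite qj rj' andbT /=.
rewrite qi ri' andbT /= negb_imply negbK in ri.
case/andP: ri => /eqP remi /eqP[ss].
apply/implyP => /eqP remj; exfalso; apply: ij.
have us : v s' = u by rewrite /u ss linvK.
have [p pE] : exists p, - (b *~ i) + r = u *~ p.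
  by rewrite -us; eexists; exact: rem0E remi.
have [q qE] : exists q, - (b *~ j) + r = u *~ q.
  by rewrite -us; eexists; exact: rem0E remj.
have bE : b *~ (j%:Z - i%:Z) = u *~ (p - q).
  rewrite !mulrzBr -pE -qE opprD opprK addrACA subrr addr0 addrC //.
have := latticeMz_orthogonal (@v0 (linv s)) bE; lia.
Qed.

End TwoStableGroup.

(** * The theorem *)

Lemma abs_neq_shrink (w w' : int * int) :
  (`|w.1|, `|w.2|) <> (`|w'.1|, `|w'.2|) ->
  (`|w'.1| < `|w.1| \/ `|w'.2| < `|w.2|) \/ (`|w.1| < `|w'.1| \/ `|w.2| < `|w'.2|).
Proof.
move=> ww.
have [lt1|lt1|e1] := ltgtP `|w.1| `|w'.1|; [by right; left|by left; left|].
have [lt2|lt2|e2] := ltgtP `|w.2| `|w'.2|; [by right; right|by left; right|].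
by case: ww; rewrite e1 e2.
Qed.

Theorem two_stable_Cstar_simple (R : realType) (mn1 mn2 kl1 kl2 : int * int) :
  mn1 <> 0 -> mn2 <> 0 -> kl1 <> 0 -> kl2 <> 0 ->
  (`|mn1.1|, `|mn1.2|) <> (`|mn2.1|, `|mn2.2|) \/
  (`|kl1.1|, `|kl1.2|) <> (`|kl2.1|, `|kl2.2|) ->
  Cstar_simple R (two_stable_group mn1 mn2 kl1 kl2).
Proof.
move=> mn1_0 mn2_0 kl1_0 kl2_0 H; apply: powers_Cstar_simple.
apply: two_stable_powers_property => //.
case: H => /abs_neq_shrink [] H.
- by exists (false, false).
- by exists (false, true).
- by exists (true, false).
- by exists (true, true).
Qed.

Theorem corollary1 (R : realType) :
  (forall m1 n1 m2 n2 k1 l1 k2 l2 : int,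
     (m1, n1) <> (0, 0) -> (m2, n2) <> (0, 0) ->
     (k1, l1) <> (0, 0) -> (k2, l2) <> (0, 0) ->
     (`|m1|, `|n1|) <> (`|m2|, `|n2|) \/ (`|k1|, `|l1|) <> (`|k2|, `|l2|) ->
     Cstar_simple R (two_stable_group (m1, n1) (m2, n2) (k1, l1) (k2, l2))) /\
  Cstar_simple R Wise_W /\
  (forall p r : int, 0 < p -> p < r -> Cstar_simple R (Brady_Bridson p r)) /\
  (forall d : int, 2 <= d -> Cstar_simple R (Wise_simple_curve d)).
Proof.
split=> [*|]; first exact: two_stable_Cstar_simple.
split; first by apply: two_stable_Cstar_simple => //; left.
split=> [p r p0 pr|d d2]; apply: two_stable_Cstar_simple => //.
- by case=> p00; rewrite p00 ltxx in p0.
- by left; case.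
- by left; case=> d1; lia.
Qed.
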